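(* Let $G$ be a $3$-connected graph with a $3$-connected simple minor $H$ and a subgraph $K$. Then $G$ has a forest $F$ with $\left\lceil(|G|-|H|+1)/2\right\rceil-|K|+1$ edges avoiding $E(K)$, such that for each edge $e$ of $F$ the graph $G/e$ is $3$-connected with an $H$-minor and has $K$ as a subgraph (considering that the labels of $V(K)$ are kept in $G/e$).
   Context: Graphs are allowed to have loops and parallel edges; $|G|$ denotes the number of vertices of $G$. A graph is $k$-connected if the removal of each set of fewer than $k$ vertices leaves a connected graph (the usual requirement that $|G|>k$ is not imposed). An $H$-minor of a graph is a minor isomorphic to $H$. $G/e$ is the graph obtained from $G$ by contracting the edge $e$.
   Formalization: H and K are assumed to have at least one vertex, and |G|>|H| is assumed when |K|=1 (if |G|=|H| and |K|=1 the formula asks for one edge, yet no G/e can have an H-minor); a negative number of edges is read as zero. *)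

(* Defs.v *)
From mathcomp Require Import all_boot.

Set Implicit Arguments.
Unset Strict Implicit.
Unset Printing Implicit Defensive.

(* Finite multigraphs: parallel edges are distinct edges with the same set of
   ends, and a loop is an edge whose set of ends is a singleton.  The graph
   without vertices is allowed, since deleting vertices may produce it. *)
Record mgraph := MGraph {
  vertex : finType;
  edge : finType;
  ends : edge -> {set vertex};
  ends_card : forall e, 0 < #|ends e| <= 2
}.

Definition simple (G : mgraph) : Prop :=
  (forall e : edge G, #|ends e| = 2) /\ injective (@ends G).

Definition adjacent (G : mgraph) : rel (vertex G) :=
  fun x y => [exists e : edge G, ends e == [set x; y]].

(* In particular the graph without vertices is connected. *)
Definition connected (G : mgraph) : Prop :=
  forall x y : vertex G, connect (@adjacent G) x y.

Section DeleteVertices.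

Variables (G : mgraph) (X : {set vertex G}).

Definition delv_vertex : finType := {v : vertex G | v \notin X}.
Definition delv_edge : finType := {e : edge G | [disjoint ends e & X]}.
Definition delv_ends (e : delv_edge) : {set delv_vertex} :=
  [set v : delv_vertex | val v \in ends (val e)].

Lemma delv_ends_card (e : delv_edge) : 0 < #|delv_ends e| <= 2.
Proof.
rewrite -(card_imset (mem (delv_ends e)) val_inj).
suff -> : val @: delv_ends e = ends (val e) by exact: ends_card.
apply/setP => x; apply/imsetP/idP => [[v + ->]|xe]; first by rewrite inE.
have xX : x \notin X by rewrite (disjointFr (valP e) xe).
by exists (Sub x xX : delv_vertex); rewrite ?inE SubK.
Qed.

Definition delete_vertices : mgraph := MGraph delv_ends_card.

End DeleteVertices.

Section DeleteEdge.

Variables (G : mgraph) (e : edge G).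

Definition dele_edge : finType := {f : edge G | f != e}.

Lemma dele_ends_card (f : dele_edge) : 0 < #|ends (val f)| <= 2.
Proof. exact: ends_card. Qed.

Definition delete_edge : mgraph := MGraph dele_ends_card.

End DeleteEdge.

Section Contract.

Variables (G : mgraph) (e : edge G).

Definition contract_block (v : vertex G) : {set vertex G} :=
  if v \in ends e then ends e else [set v].

(* The vertices of G/e are the blocks of the partition of V(G) in which the
   ends of e are identified and every other vertex is alone. *)
Definition contract_vertex : finType :=
  {B : {set vertex G} | B \in codom contract_block}.
Definition contract_edge : finType := {f : edge G | f != e}.

Definition contract_map (v : vertex G) : contract_vertex :=
  Sub (contract_block v) (codom_f contract_block v).

Definition contract_ends (f : contract_edge) : {set contract_vertex} :=
  contract_map @: ends (val f).

Lemma contract_ends_card (f : contract_edge) : 0 < #|contract_ends f| <= 2.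
Proof.
have /andP[f_gt0 f_le2] := ends_card (val f).
rewrite (leq_trans (leq_imset_card _ _) f_le2) andbT.
by move: f_gt0; rewrite !card_gt0 imset_eq0.
Qed.

Definition contract : mgraph := MGraph contract_ends_card.

End Contract.

Definition kconnected (k : nat) (G : mgraph) : Prop :=
  forall X : {set vertex G}, #|X| < k -> connected (delete_vertices X).

Definition isomorphic (G H : mgraph) : Prop :=
  exists (f : vertex G -> vertex H) (g : edge G -> edge H),
    [/\ bijective f, bijective g & forall e, ends (g e) = f @: ends e].

(* has_minor G H: some graph isomorphic to H is obtained from G by a sequence
   of vertex deletions, edge deletions and edge contractions. *)
Inductive has_minor : mgraph -> mgraph -> Prop :=
| has_minor_iso G H : isomorphic G H -> has_minor G H
| has_minor_delv G H (v : vertex G) :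
    has_minor (delete_vertices [set v]) H -> has_minor G H
| has_minor_dele G H (e : edge G) :
    has_minor (delete_edge e) H -> has_minor G H
| has_minor_contract G H (e : edge G) :
    has_minor (contract e) H -> has_minor G H.

Record subgraph (G : mgraph) := Subgraph {
  svertex : {set vertex G};
  sedge : {set edge G};
  sends : forall e, e \in sedge -> ends e \subset svertex
}.

(* A cycle of length n.+1 through the vertices v i and the edges c i, indexed
   cyclically; length 1 is a loop and length 2 is a pair of parallel edges. *)
Definition is_cycle (G : mgraph) (n : nat)
    (v : 'I_n.+1 -> vertex G) (c : 'I_n.+1 -> edge G) : Prop :=
  [/\ injective v, injective c & forall i, ends (c i) = [set v i; v (ordS i)]].

Definition forest (G : mgraph) (F : subgraph G) : Prop :=
  forall n (v : 'I_n.+1 -> vertex G) (c : 'I_n.+1 -> edge G),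
    is_cycle v c -> ~ (forall i, c i \in sedge F).

(* G/e has K as a subgraph with the labels of V(K) kept: the vertices of K stay
   pairwise distinct in G/e, and their images, together with the edges of K,
   form a subgraph of G/e.  When e has exactly one end in K, the vertex created
   by the contraction carries the label of that end. *)
Definition keeps_subgraph (G : mgraph) (e : edge G) (K : subgraph G) : Prop :=
  {in svertex K &, injective (contract_map e)} /\
  exists K' : subgraph (contract e),
    svertex K' = contract_map e @: svertex K /\ val @: sedge K' = sedge K.

(* Main.v *)
(** Call an edge xy _good_ when contracting it keeps both 3-connectivity and the
    minor H.  A model of H in G is a surjection V(G) -> V(H) with connected
    fibres, and xy preserves H iff some model identifies x and y.

    If xy preserves H but G/xy is not 3-connected, there is a 3-cut {x, y, z},
    and since H is 3-connected one side A of it contains no fibre other than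
    those of x and z.  All of A can then be moved into either of these two
    fibres, so every edge meeting A preserves H.  Shrinking A shows that a vertex
    x lying on an H-preserving edge but on no good edge has a neighbour w in A
    of degree three whose two other edges are good; applied again to xw, this
    yields a second such w.  Each w serves only one x.  In a component of the
    good graph with s > 1 vertices at most 2(s - 2) vertices are of this kind,
    while fewer than |H| vertices lie on no H-preserving edge, and summing over
    components shows that there are at most (|G| + |H| - 1)/2 of them.

    Finally a forest of good edges is grown greedily in G with V(K)
    identified to one vertex: it loses at most |K| - 1 edges, and none of its
    edges has both ends in K. *)

Require Import Defs.
From mathcomp Require Import all_boot.
From mathcomp Require Import zify.

Set Implicit Arguments.
Unset Strict Implicit.
Unset Printing Implicit Defensive.

(** * Separations of order three *)

Section Separations.

Variables (V : finType) (r : rel V).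

(* A is a union of components of r - S, and not all of them. *)
Definition separates (S A : {set V}) : bool :=
  [&& A != set0, [disjoint A & S], A :|: S != setT &
      [forall a in A, forall b, r a b ==> (b \in A :|: S)]].

Lemma separatesP (S A : {set V}) :
  reflect [/\ exists a, a \in A, forall a, a \in A -> a \notin S,
              exists b, b \notin A /\ b \notin S &
              forall a b, a \in A -> r a b -> b \notin A -> b \in S]
          (separates S A).
Proof.
apply: (iffP and4P) => [[/set0Pn A0 dAS nT /forall_inP cl]|[A0 dAS [c [cA cS]] cl]].
  split=> //.
  - by move=> a aA; rewrite (disjointFr dAS).
  - have /subsetPn[b _ nb] : ~~ (setT \subset A :|: S).
      by apply: contraNN nT; rewrite -subTset.
    by exists b; move: nb; rewrite inE negb_or => /andP.
  - move=> a b aA rab bA; move/forallP/(_ b): (cl a aA).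
    by rewrite rab inE (negPf bA).
split.
- exact/set0Pn.
- by rewrite disjoint_subset; apply/subsetP => a /dAS.
- by apply/eqP => /setP/(_ c); rewrite !inE (negPf cA) (negPf cS).
- apply/forall_inP => a aA; apply/forallP => b; apply/implyP => rab.
  by rewrite inE; case bA: (b \in A) => //=; apply: cl rab _; rewrite ?bA.
Qed.

Definition connected3 : Prop :=
  forall S A : {set V}, #|S| <= 2 -> ~~ separates S A.

(* For 3-connected r, a cut {x, y, z} is what becomes a 2-cut once xy is
   contracted; z may be x or y, but then the cut is too small to exist. *)
Definition contractible3 (x y : V) : bool :=
  [forall z, forall A : {set V}, ~~ separates [set x; y; z] A].

Lemma contractible3PnE x y :
  ~~ contractible3 x y -> exists z A, separates [set x; y; z] A.
Proof.
rewrite negb_forall => /existsP[z]; rewrite negb_forall => /existsP[A] /negPn sA.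
by exists z, A.
Qed.

Lemma contractible3C x y : contractible3 x y = contractible3 y x.
Proof. by apply: eq_forallb => z; rewrite (setUC [set x]). Qed.

Hypotheses (rC : symmetric r) (r3 : connected3).

Lemma separatesC (S A : {set V}) : separates S A -> separates S (~: (A :|: S)).
Proof.
move=> /separatesP[[a aA] dAS [b [bA bS]] cl]; apply/separatesP; split.
- by exists b; rewrite !inE (negPf bA) (negPf bS).
- by move=> c; rewrite !inE negb_or => /andP[].
- by exists a; rewrite !inE aA (dAS a aA).
move=> c d; rewrite 2!in_setC negbK !in_setU negb_or => /andP[cA cS] rcd /orP[dA|//].
by case/negP: cS; apply: (cl d) => //; rewrite rC.
Qed.

(* p and q may lie in A: only the boundary of A matters. *)
Lemma no_small_cut p q a b (A : {set V}) :
  (forall u v, u \in A -> r u v -> v \notin A -> v = p \/ v = q) ->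
  a \in A -> b \notin A -> b <> p -> b <> q -> False.
Proof.
move=> cl aA bA bp bq.
have : #|[set p; q] :\: A| <= 2.
  by rewrite (leq_trans (subset_leq_card (subsetDl _ _))) // cards2; case: eqP.
move=> /(@r3 _ A)/negP; apply; apply/separatesP; split.
- by exists a.
- by move=> c cA; rewrite !inE cA.
- by exists b; rewrite !inE bA; split=> //; apply/norP; split; apply/eqP.
- by move=> c d cA rcd dA; rewrite !inE dA; case: (cl c d) => // ->; rewrite eqxx ?orbT.
Qed.

Lemma separates_neq x y z (A : {set V}) : separates [set x; y; z] A ->
  [/\ x != y, x != z & y != z].
Proof.
move=> /separatesP[[a aA] dA [b [bA bS]] cl].
have K p q : (forall v, v \in [set x; y; z] -> v = p \/ v = q) ->
     [set p; q] \subset [set x; y; z] -> False.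
  move=> h /subsetP s; apply: (@no_small_cut p q a b A) => //.
  - by move=> u v uA ruv vA; apply: h; apply: cl ruv _.
  - by move=> bp; case/negP: bS; apply: s; rewrite !inE bp eqxx.
  - by move=> bp; case/negP: bS; apply: s; rewrite !inE bp eqxx orbT.
split; apply/eqP => E; subst.
- apply: (K y z); last by apply/subsetP => v; rewrite !inE => /orP[]->; rewrite ?orbT.
  by move=> v; rewrite !inE orbb => /orP[]/eqP; auto.
- apply: (K z y); last by apply/subsetP => v; rewrite !inE => /orP[]->; rewrite ?orbT.
  by move=> v; rewrite !inE => /orP[/orP[]|]/eqP; auto.
- apply: (K x z); last by apply/subsetP => v; rewrite !inE => /orP[]->; rewrite ?orbT.
  by move=> v; rewrite !inE => /orP[/orP[]|]/eqP; auto.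
Qed.

Lemma separates_adj (S A : {set V}) p q z : separates S A ->
  (forall v, v \in S -> [\/ v = p, v = q | v = z]) -> p \in S -> q \in S ->
  exists2 a, a \in A & r z a.
Proof.
move=> /separatesP[[a aA] dA [b [bA bS]] cl] SE pS qS.
case: (boolP [exists a in A, r z a]) => [/exists_inP[c cA rzc]|]; first by exists c.
rewrite negb_exists_in => /forall_inP nz; exfalso.
apply: (@no_small_cut p q a b A) => //.
- move=> u v uA ruv vA; case: (SE v (cl _ _ uA ruv vA)); auto.
  by move=> vz; case/negP: (nz u uA); rewrite -vz rC.
- by move=> bp; rewrite bp pS in bS.
- by move=> bq; rewrite bq qS in bS.
Qed.

Lemma contractible3_third w x y z : r x y ->
  (forall v, r w v -> [\/ v = x, v = y | v = z]) -> contractible3 w z.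
Proof.
move=> rxy Nw; apply/forallP => v; apply/forallP => P; apply/negP.
have K Q : separates [set w; z; v] Q -> x \notin Q -> y \notin Q -> False.
  move=> /separatesP[[a aQ] dQ [b [bQ]]]; rewrite !inE !negb_or.
  move=> /andP[/andP[_ /eqP bz] /eqP bv] cl xQ yQ.
  apply: (@no_small_cut z v a b Q) => // c d cQ rcd dQ'.
  move: (cl c d cQ rcd dQ'); rewrite !inE => /orP[/orP[]|]/eqP; auto => dw.
  move: rcd; rewrite dw rC => /Nw[] E; subst c.
  - by rewrite cQ in xQ.
  - by rewrite cQ in yQ.
  - by move: (dQ _ cQ); rewrite !inE eqxx orbT.
move=> sP; have /separatesP[_ _ _ cl] := sP.
case xP: (x \in P).
  apply: (K _ (separatesC sP)); rewrite inE negbK inE ?xP //.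
  by case yP: (y \in P) => //=; apply: cl rxy _; rewrite ?yP.
case yP: (y \in P); last by apply: (K P); rewrite ?xP ?yP.
apply: (K _ (separatesC sP)); rewrite inE negbK inE ?yP // ?xP /=.
by apply: (cl y); rewrite ?xP // rC.
Qed.

Lemma separates3P x y z (A : {set V}) :
  reflect [/\ exists a, a \in A, [/\ x \notin A, y \notin A & z \notin A],
              exists b, [/\ b \notin A, b <> x, b <> y & b <> z] &
              forall a b, a \in A -> r a b ->
                [\/ b \in A, b = x, b = y | b = z]]
          (separates [set x; y; z] A).
Proof.
have S v : reflect [\/ v = x, v = y | v = z] (v \in [set x; y; z]).
  by rewrite !inE -orbA; apply: (iffP or3P) => -[/eqP E|/eqP E|/eqP E];
     [exact: Or31|exact: Or32|exact: Or33|exact: Or31|exact: Or32|exact: Or33].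
apply: (iffP (separatesP _ _)) => [[A0 dA [b [bA bS]] cl]|[A0 [xA yA zA] [b [bA bx byy bz]] cl]].
  split=> //.
  - by split; apply/negP => /dA/negP; apply; apply/S; constructor.
  - exists b; split=> // E; case/negP: bS; apply/S; [exact: Or31|exact: Or32|exact: Or33].
  - move=> c d cA rcd; case dA': (d \in A); first exact: Or41.
    by case/S: (cl c d cA rcd (negbT dA')) => ->; [exact: Or42|exact: Or43|exact: Or44].
split=> //.
- move=> a aA; apply/S => -[] E; subst; [move: xA|move: yA|move: zA]; by rewrite aA.
- by exists b; split=> //; apply/S => -[].
- move=> c d cA rcd dA; apply/S; case: (cl c d cA rcd) => [dA'|||].
  + by rewrite dA' in dA.
  + exact: Or31.
  + exact: Or32.
  + exact: Or33.
Qed.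

Lemma separates_descent x y z t u (C P : {set V}) :
  separates [set x; y; z] C -> u \in C -> separates [set x; u; t] P ->
  C = [set u] \/
  exists q (C' : {set V}),
    [/\ separates [set x; u; q] C', C' \subset C & u \notin C'].
Proof.
move=> sC uC sP.
have [xy xz yz] := separates_neq sC.
have [xu xt ut] := separates_neq sP.
have /separates3P[_ [xC yC zC] [d [dC dx dy dz]] clC] := sC.
have sub Q q : Q :&: C != set0 -> q \notin Q -> u \notin Q -> x \notin Q ->
    (forall a b, a \in Q :&: C -> r a b -> [\/ b \in Q :&: C, b = x, b = u | b = q]) ->
    (exists b, [/\ b \notin Q, b <> x, b <> u & b <> q]) ->
    exists q (C' : {set V}),
      [/\ separates [set x; u; q] C', C' \subset C & u \notin C'].
  move=> /set0Pn[a aQ] qQ uQ xQ cl [b [bQ bx bu bq]].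
  exists q, (Q :&: C); split; rewrite ?subsetIr //; last by rewrite inE (negPf uQ).
  apply/separates3P; split=> //; first by exists a.
    by split; rewrite inE negb_and ?xQ ?uQ ?qQ.
  by exists b; rewrite inE (negPf bQ).
have side Q : separates [set x; u; t] Q -> y \notin Q -> z \notin Q ->
    exists q (C' : {set V}),
      [/\ separates [set x; u; q] C', C' \subset C & u \notin C'].
  move=> /separates3P[[a aQ] [xQ uQ tQ] [b [bQ bx bu bt]] clQ] yQ zQ.
  case: (set_0Vmem (Q :&: C)) => [Q0|[c cQ]].
    exfalso; apply: (@no_small_cut x t a b Q) => // v v' vQ rv v'Q.
    case: (clQ v v' vQ rv) => [E|E|E|E]; auto; first by rewrite E in v'Q.
    subst v'; rewrite rC in rv; case: (clC u v uC rv) => [vC|E|E|E]; last 3 first.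
    - by move: xQ; rewrite -E vQ.
    - by move: yQ; rewrite -E vQ.
    - by move: zQ; rewrite -E vQ.
    by have := in_set0 v; rewrite -Q0 inE vQ vC.
  apply: (sub Q t) => //; first by apply/set0Pn; exists c.
    move=> v v'; rewrite inE => /andP[vQ vC] rv.
    case: (clQ v v' vQ rv) => [E|->|->|->];
      [|exact: Or42|exact: Or43|exact: Or44].
    apply: Or41; rewrite inE E; case: (clC v v' vC rv) => // E'; subst v'.
    - by rewrite E in xQ.
    - by rewrite E in yQ.
    - by rewrite E in zQ.
  by exists b.
have inside Q y' z' : (forall a b, a \in C -> r a b -> [\/ b \in C, b = x, b = y' | b = z']) ->
    separates [set x; u; t] Q -> y' \notin C -> y' \in Q ->
    z' \notin Q -> z' <> x -> z' <> t -> z' <> u -> y' <> z' -> t \notin C -> x <> y' ->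
    (exists q (C' : {set V}),
      [/\ separates [set x; u; q] C', C' \subset C & u \notin C'])
    \/ Q :&: C = set0.
  move=> clC' /separates3P[[a aQ] [xQ uQ tQ] [b [bQ bx bu bt]] clQ].
  move=> y'C y'Q z'Q z'x z't z'u y'z' tC xy'.
  case: (set_0Vmem (Q :&: C)) => [|[c cQ]]; [by right|left].
  exists y', (Q :&: C); split; rewrite ?subsetIr //; last by rewrite inE (negPf uQ).
  apply/separates3P; split; first by exists c.
  - by split; rewrite inE negb_and ?xQ ?uQ ?y'C ?orbT.
  - by exists z'; rewrite inE (negPf z'Q); split=> //; apply/nesym.
  - move=> v v'; rewrite inE => /andP[vQ vC] rv.
    case: (clQ v v' vQ rv) => [E|->|->|E]; [|exact: Or42|exact: Or43|].
      case: (clC' v v' vC rv) => [E'|E'|E'|E'].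
      + by apply: Or41; rewrite inE E.
      + exact: Or42.
      + exact: Or44.
      + by move: z'Q; rewrite -E' E.
    case: (clC' v v' vC rv) => [E'|E'|E'|E'].
    + by rewrite -E E' in tC.
    + exact: Or42.
    + exact: Or44.
    + by case: z't; rewrite -E' E.
have outside Q y' z' : (forall a b, a \in C -> r a b -> [\/ b \in C, b = x, b = y' | b = z']) ->
    separates [set x; u; t] Q -> z' \notin Q -> z' \notin C -> z' <> x -> y' <> z' -> t \in C ->
    d <> x -> d <> y' -> d <> z' -> d \notin Q.
  move=> clC' /separates3P[[a aQ] [xQ uQ tQ] [b [bQ bx bu bt]] clQ].
  move=> z'Q z'C z'x y'z' tC dx' dy' dz'; apply/negP => dQ.
  apply: (@no_small_cut x y' d z' (Q :\: (C :|: [set y']))) => //.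
  - move=> v v'; rewrite !inE negb_or => /andP[/andP[vC vy'] vQ] rv v'Q.
    case: (eqVneq v' y') => [|v'y']; [by auto|left].
    case: (boolP (v' \in C)) => [v'C|v'C].
      rewrite rC in rv; case: (clC' v' v v'C rv) => [E|E|E|E].
      + by rewrite E in vC.
      + by rewrite -E vQ in xQ.
      + by rewrite E eqxx in vy'.
      + by rewrite -E vQ in z'Q.
    case: (clQ v v' vQ rv) => [E|//|E|E].
    + by move: v'Q; rewrite E (negPf v'y') (negPf v'C).
    + by rewrite E uC in v'C.
    + by rewrite E tC in v'C.
  - by rewrite !inE dQ (negPf dC) andbT; apply/eqP.
  - by rewrite !inE (negPf z'Q) andbF.
  - exact: nesym.
have clC' a b : a \in C -> r a b -> [\/ b \in C, b = x, b = z | b = y].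
  by move=> aC /(clC a b aC)[]; [exact: Or41|exact: Or42|exact: Or44|exact: Or43].
set Q := ~: (P :|: [set x; u; t]).
have sQ : separates [set x; u; t] Q by exact: separatesC.
have yu : y <> u by move=> E; rewrite E uC in yC.
have zu : z <> u by move=> E; rewrite E uC in zC.
have inQ v : v \notin P -> v <> x -> v <> u -> v <> t -> v \in Q.
  by move=> vP /eqP vx /eqP vu /eqP vt; rewrite !inE !negb_or vP vx vu vt.
have nQ v : v \in P -> v \notin Q by move=> vP; rewrite !inE vP.
have nt v : v = t -> v \notin P /\ v \notin Q.
  move=> ->; have /separates3P[_ [_ _ tP] _ _] := sP.
  by have /separates3P[_ [_ _ tQ] _ _] := sQ.
have final y' z' : (forall a b, a \in C -> r a b -> [\/ b \in C, b = x, b = y' | b = z']) ->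
    y' \notin C -> z' \notin C -> y' \in P -> z' \in Q -> y' <> u -> z' <> u ->
    d <> y' -> d <> z' ->
    C = [set u] \/ exists q (C' : {set V}),
      [/\ separates [set x; u; q] C', C' \subset C & u \notin C'].
  move=> cl1 y'C z'C y'P z'Q y'u z'u dy' dz'.
  have cl2 a b : a \in C -> r a b -> [\/ b \in C, b = x, b = z' | b = y'].
    by move=> aC /(cl1 a b aC)[]; [exact: Or41|exact: Or42|exact: Or44|exact: Or43].
  have z'P : z' \notin P by apply: contraL z'Q; exact: nQ.
  have y'Q : y' \notin Q by exact: nQ.
  have y'x : y' <> x.
    by move=> E; have /separates3P[_ [xP _ _] _ _] := sP; rewrite -E y'P in xP.
  have z'x : z' <> x.
    by move=> E; have /separates3P[_ [xQ _ _] _ _] := sQ; rewrite -E z'Q in xQ.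
  have y't : y' <> t by move=> /nt[]; rewrite y'P.
  have z't : z' <> t by move=> /nt[_]; rewrite z'Q.
  have y'z' : y' <> z' by move=> E; rewrite E z'Q in y'Q.
  case: (boolP (t \in C)) => tC.
    have dP := outside P y' z' cl1 sP z'P z'C z'x y'z' tC dx dy' dz'.
    have dQ := outside Q z' y' cl2 sQ y'Q y'C y'x (nesym y'z') tC dx dz' dy'.
    case/negP: dQ; apply: inQ => // E; first by rewrite E uC in dC.
    by rewrite E tC in dC.
  case: (inside P y' z' cl1 sP y'C y'P z'P z'x z't z'u y'z' tC (nesym y'x)) => [|P0]; first by right.
  case: (inside Q z' y' cl2 sQ z'C z'Q y'Q y'x y't y'u (nesym y'z') tC (nesym z'x)) => [|Q0]; first by right.
  left; apply/eqP; rewrite eqEsubset sub1set uC andbT; apply/subsetP => v vC.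
  rewrite inE; apply/eqP; case: (eqVneq v u) => // /eqP vu; exfalso.
  have vP : v \notin P.
    by apply/negP => vP; have := in_set0 v; rewrite -P0 inE vP vC.
  have := in_set0 v; rewrite -Q0 inE vC andbT => /negP; apply; apply: inQ => //.
    by move=> E; rewrite -E vC in xC.
  by move=> E; rewrite -E vC in tC.
case: (boolP (y \in P)) => yP; case: (boolP (z \in P)) => zP.
- by right; apply: (side Q) => //; exact: nQ.
- case: (boolP (z \in Q)) => zQ; first exact: (final y z).
  by right; apply: (side Q) => //; exact: nQ.
- case: (boolP (y \in Q)) => yQ; first exact: (final z y).
  by right; apply: (side Q) => //; exact: nQ.
- by right; apply: (side P).
Qed.

End Separations.

Section Uncrossing.

Variables (V : finType) (r : rel V).
Hypotheses (rC : symmetric r) (rI : irreflexive r) (r3 : connected3 r).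

Lemma separates_uncross w x y z t t' (Y X : {set V}) : r x y ->
  (forall v, r w v -> [\/ v = x, v = y | v = z]) ->
  separates r [set w; x; t] Y -> separates r [set w; y; t'] X ->
  forall v, r x v -> [\/ v = w, v = y | v = t'].
Proof.
move=> rxy Nw.
have split p q u (A : {set V}) : separates r [set w; p; u] A ->
    (forall v, r w v -> [\/ v = p, v = q | v = z]) ->
    exists B, [/\ separates r [set w; p; u] B, q \in B & z \in ~: (B :|: [set w; p; u])].
  move=> sA Nw'.
  have hit B : separates r [set w; p; u] B -> (q \in B) || (z \in B).
    move=> sB.
    have [|||b bB rwb] := @separates_adj _ _ rC r3 _ _ p u w sB.
    - by move=> v; rewrite !inE => /orP[/orP[]|]/eqP; [exact: Or33|exact: Or31|exact: Or32].
    - by rewrite !inE eqxx orbT.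
    - by rewrite !inE eqxx orbT.
    have /separates3P[_ [_ pB _] _ _] := sB.
    case: (Nw' b rwb) => E; subst b; rewrite ?bB ?orbT //.
    by rewrite bB in pB.
  have sA' := separatesC rC sA.
  case/orP: (hit _ sA') (hit _ sA) => [qA'|zA'] /orP[qA|zA].
  - by move: qA'; rewrite !inE qA.
  - exists (~: (A :|: [set w; p; u])); split=> //.
    have /separates3P[_ [wA pA uA] _ _] := sA.
    by rewrite !inE; apply/negP; case/orP; rewrite ?zA //; case/orP => [/orP[]|] /eqP E;
      move: wA pA uA; rewrite -E zA.
  - by exists A.
  - by move: zA'; rewrite !inE zA.
move=> /(split x y) [//|{}Y [sY yY]]; set Z := ~: _ => zZ.
move=> /(split y x) [v /Nw[]|{}X [sX xX]]; [exact: Or32|exact: Or31|exact: Or33|].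
set Z' := ~: _ => zZ'.
have sZ : separates r [set w; x; t] Z by exact: separatesC.
have sZ' : separates r [set w; y; t'] Z' by exact: separatesC.
have /separates3P[_ [wY xY tY] _ clY] := sY.
have /separates3P[_ [wX yX t'X] _ clX] := sX.
have /separates3P[_ [wZ xZ tZ] _ clZ] := sZ.
have /separates3P[_ [wZ' yZ' t'Z'] _ clZ'] := sZ'.
have inZ v : v \notin Y -> v <> w -> v <> x -> v <> t -> v \in Z.
  by move=> vY /eqP vx /eqP vu /eqP vt; rewrite !inE !negb_or vY vx vu vt.
have inZ' v : v \notin X -> v <> w -> v <> y -> v <> t' -> v \in Z'.
  by move=> vY /eqP vx /eqP vu /eqP vt; rewrite !inE !negb_or vY vx vu vt.
have YZ v : v \in Y -> v \notin Z by move=> vY; rewrite !inE vY.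
have XZ' v : v \in X -> v \notin Z' by move=> vX; rewrite !inE vX.
have [wx wt xt] := separates_neq r3 sY.
have [wy wt' yt'] := separates_neq r3 sX.
clearbody Z Z'.
have yNt' : y <> t' by apply/eqP.
have xNt : x <> t by apply/eqP.
have xNw : x <> w by move=> E; rewrite E eqxx in wx.
have yNw : y <> w by move=> E; rewrite E eqxx in wy.
have yNx : y <> x by move=> E; rewrite E xX in yX.
have yNt : y <> t by move=> E; rewrite -E yY in tY.
have ZZ' u v : u \in Z :&: Z' -> r u v -> v \notin Z :&: Z' ->
    [\/ v = w, v = t /\ (t \in Z' \/ t = t') | v = t' /\ t' \in Z].
  rewrite !inE => /andP[uZ uZ'] ruv.
  case: (clZ u v uZ ruv) => [vZ|E|E|E]; first rewrite vZ /= => vZ'.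
  - case: (clZ' u v uZ' ruv) => [E|E|E|E]; first by rewrite E in vZ'.
    + exact: Or31.
    + by have := YZ y yY; rewrite -E vZ.
    + by rewrite -E; apply: Or33.
  - by move=> _; apply: Or31.
  - case: (clZ' u v uZ' ruv) => [E'|E'|E'|E']; rewrite E in E'.
    + by have := XZ' x xX; rewrite E'.
    + by case: xNw.
    + by case: yNx.
    + by subst; have /separates3P[_ [_ _]] := sX; rewrite xX.
  - move=> _; case: (clZ' u v uZ' ruv) => [E'|E'|E'|E'].
    + by apply: Or32; split=> //; left; rewrite -E.
    + exact: Or31.
    + by case: yNt; rewrite -E.
    + by apply: Or32; split=> //; right; rewrite -E.
have zZZ' : z \in Z :&: Z' by rewrite inE zZ.
have t'Z : t' \in Z.
  case: (boolP (t' \in Z)) => // t'Z; exfalso.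
  apply: (@no_small_cut _ _ r3 w t z x (Z :&: Z')) => //.
    move=> u v uZ ruv vZ; case: (ZZ' u v uZ ruv vZ) => [|[]|[]]; auto.
    by move=> _; rewrite (negPf t'Z).
  by rewrite inE (negPf xZ).
have tNt' : t <> t' by move=> E; rewrite -E in t'Z; rewrite t'Z in tZ.
have tZ'' : t \in Z'.
  case: (boolP (t \in Z')) => // tZ'; exfalso.
  apply: (@no_small_cut _ _ r3 w t' z y (Z :&: Z')) => //.
    move=> u v uZ ruv vZ; case: (ZZ' u v uZ ruv vZ) => [|[vt []]|[]]; auto.
      by rewrite (negPf tZ').
    by move=> E; right; rewrite vt.
  by rewrite inE (negPf yZ') andbF.
have tX : t \notin X by apply: contraL tZ''; apply: XZ'.
have t'Y : t' \notin Y by apply: contraL t'Z; apply: YZ.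
have zX : z \notin X by apply: contraL zZ'; apply: XZ'.
have zY : z \notin Y by apply: contraL zZ; apply: YZ.
have zNx : z <> x by move=> E; rewrite -E zZ in xZ.
have zNy : z <> y by move=> E; rewrite -E zZ' in yZ'.
have yZ : y \notin Z by exact: YZ.
have Xx v : v \in X -> v = x.
  move=> vX; case: (eqVneq v x) => // /eqP vx; exfalso.
  have vw : v <> w by move=> E; rewrite -E vX in wX.
  have vt : v <> t by move=> E; rewrite -E vX in tX.
  case: (boolP (v \in Y)) => vY.
    apply: (@no_small_cut _ _ r3 x y v z (Y :&: X)) => //; last 2 first.
    - by rewrite inE vY.
    - by rewrite inE (negPf zY).
    move=> a b; rewrite !inE => /andP[aY aX] rab.
    have bw : b <> w.
      move=> E; move: rab; rewrite E rC => /Nw[] E'; subst a.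
      - by rewrite aY in xY.
      - by rewrite aX in yX.
      - by rewrite aX in zX.
    case: (clY a b aY rab) => [bY|//|->|E]; [|by auto|].
      rewrite bY /= => bX; right; case: (clX a b aX rab) => [E|//|//|E].
        by rewrite E in bX.
      by rewrite -E bY in t'Y.
    case: (clX a b aX rab) => [E'|//|E'|E'].
    - by rewrite -E E' in tX.
    - by case: yNt; rewrite -E'.
    - by case: tNt'; rewrite -E.
  have vZ := inZ v vY vw vx vt.
  apply: (@no_small_cut _ _ r3 x t' v y (Z :&: X)) => //; last 2 first.
  - by rewrite inE vZ.
  - by rewrite inE (negPf yZ).
  move=> a b; rewrite !inE => /andP[aZ aX] rab.
  have bw : b <> w.
    move=> E; move: rab; rewrite E rC => /Nw[] E'; subst a.
    - by rewrite aZ in xZ.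
    - by rewrite aX in yX.
    - by rewrite aX in zX.
  case: (clZ a b aZ rab) => [bZ|//|->|E]; [|by auto|].
    rewrite bZ /= => bX; right; case: (clX a b aX rab) => [E|//|E|//].
      by rewrite E in bX.
    by rewrite -E bZ in yZ.
  case: (clX a b aX rab) => [E'|//|E'|E'].
  - by rewrite -E E' in tX.
  - by case: yNt; rewrite -E'.
  - by case: tNt'; rewrite -E.
move=> v rxv; case: (clX x v xX rxv) => [/Xx vx|||]; first 1 last.
- exact: Or31.
- exact: Or32.
- exact: Or33.
by move: rxv; rewrite vx rI.
Qed.

End Uncrossing.

(** * Minors as vertex maps *)

Section MinorMaps.

Variables (V T : finType) (r : rel V) (rT : rel T).

Definition fibres_connected (f : V -> T) : bool :=
  [forall U : {set V},
     [forall u in U, forall v, (r u v && (f u == f v)) ==> (v \in U)] ==>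
     [forall u in U, forall v, (f u == f v) ==> (v \in U)]].

Lemma fibres_connectedP f :
  reflect (forall U : {set V},
             (forall u v, u \in U -> r u v -> f u = f v -> v \in U) ->
             forall u v, u \in U -> f u = f v -> v \in U)
          (fibres_connected f).
Proof.
apply: (iffP forallP) => [H U cl u v uU fuv|H U].
  move/implyP: (H U) => hU.
  have /hU/forall_inP/(_ u uU)/forallP/(_ v)/implyP :
      [forall a in U, forall b, (r a b && (f a == f b)) ==> (b \in U)].
    apply/forall_inP => a aU; apply/forallP => b; apply/implyP => /andP[rab /eqP fab].
    exact: cl fab.
  by apply; apply/eqP.
apply/implyP => /forall_inP cl; apply/forall_inP => u uU; apply/forallP => v.
apply/implyP => /eqP fuv; apply: (H U _ u v uU fuv) => a b aU rab fab.
by move/forallP/(_ b): (cl a aU); rewrite rab fab eqxx.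
Qed.

Definition minor_map (f : V -> T) : bool :=
  [&& [forall a, exists u, f u == a], fibres_connected f &
      [forall a, forall b, rT a b ==>
         [exists u, exists v, [&& f u == a, f v == b & r u v]]]].

Lemma minor_mapP f :
  reflect [/\ forall a, exists u, f u = a, fibres_connected f &
              forall a b, rT a b -> exists u v, [/\ f u = a, f v = b & r u v]]
          (minor_map f).
Proof.
apply: (iffP and3P) => -[s c e]; split=> //.
- by move=> a; have /existsP[u /eqP] := forallP s a; exists u.
- move=> a b rab; move/forallP/(_ a)/forallP/(_ b): e; rewrite rab.
  by move=> /existsP[u /existsP[v /and3P[/eqP fu /eqP fv ruv]]]; exists u, v.
- by apply/forallP => a; have [u fu] := s a; apply/existsP; exists u; apply/eqP.
- apply/forallP => a; apply/forallP => b; apply/implyP => /e[u [v [fu fv ruv]]].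
  by apply/existsP; exists u; apply/existsP; exists v; rewrite fu fv !eqxx.
Qed.

Lemma eq_minor_map f g : f =1 g -> minor_map f -> minor_map g.
Proof.
move=> fg /minor_mapP[s /fibres_connectedP c e]; apply/minor_mapP; split.
- by move=> a; have [u <-] := s a; exists u.
- apply/fibres_connectedP => U cl u v uU guv; apply: (c U _ u v uU).
    by move=> a b aU rab fab; apply: cl rab _; rewrite -?fg.
  by rewrite !fg.
- by move=> a b /e[u [v [fu fv ruv]]]; exists u, v; rewrite -!fg.
Qed.

Definition contractible_minor (x y : V) : bool :=
  r x y && [exists f : {ffun V -> T}, minor_map f && (f x == f y)].

Lemma contractible_minorP x y :
  reflect (r x y /\ exists2 f : V -> T, minor_map f & f x = f y)
          (contractible_minor x y).
Proof.
apply: (iffP andP) => -[rxy]; split=> //.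
  by move: b => /existsP[f /andP[mf /eqP fxy]]; exists f.
case: b => f mf fxy; apply/existsP; exists [ffun v => f v].
by rewrite !ffunE fxy eqxx andbT; apply: eq_minor_map mf => v; rewrite ffunE.
Qed.

Hypotheses (rC : symmetric r) (rI : irreflexive r) (r3 : connected3 r).
Hypotheses (rTI : irreflexive rT) (rT3 : connected3 rT).

Lemma contractible_minorC x y : contractible_minor x y = contractible_minor y x.
Proof.
by rewrite /contractible_minor rC; congr (_ && _); apply: eq_existsb => f; rewrite eq_sym.
Qed.

Definition free (A : {set V}) : Prop :=
  forall u v, u \in A -> r u v -> contractible_minor u v.

(* The part of a fibre of x or z that remains outside A stays connected: every
   passage through A starts and ends at x, y or z, and xy is an edge. *)
Lemma minor_map_reassign (f : V -> T) x y z (A : {set V}) (c : T) :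
  minor_map f -> f x = f y -> r x y -> separates r [set x; y; z] A ->
  (forall u, u \in A -> f u = f x \/ f u = f z) -> f x <> f z ->
  c = f x \/ c = f z ->
  minor_map (fun u => if u \in A then c else f u).
Proof.
move=> /minor_mapP[s /fibres_connectedP con e] fxy rxy sA fA fxz cE.
have /separates3P[A0 [xA yA zA] [d [dA dx dy dz]] cl] := sA.
have adj v : v = x \/ v = y \/ v = z -> exists2 a, a \in A & r v a.
  have inS w : w \in [set x; y; z] -> [\/ w = x, w = y | w = z].
    by rewrite !inE => /orP[/orP[]|]/eqP; [exact: Or31|exact: Or32|exact: Or33].
  case=> [->|[->|->]].
  - apply: (@separates_adj _ _ rC r3 _ _ y z x sA); rewrite ?inE ?eqxx ?orbT //.
    by move=> w /inS[]; [exact: Or33|exact: Or31|exact: Or32].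
  - apply: (@separates_adj _ _ rC r3 _ _ x z y sA); rewrite ?inE ?eqxx ?orbT //.
    by move=> w /inS[]; [exact: Or31|exact: Or33|exact: Or32].
  - apply: (@separates_adj _ _ rC r3 _ _ x y z sA); rewrite ?inE ?eqxx ?orbT //.
pose g u := if u \in A then c else f u.
rewrite -[minor_map _]/(minor_map g).
have gA u : u \in A -> g u = c by rewrite /g => ->.
have gN u : u \notin A -> g u = f u by rewrite /g => /negPf->.
apply/minor_mapP; split.
- move=> a; have [u fu] := s a; case: (boolP (u \in A)) => uA.
    case: (fA u uA); rewrite fu => ->; [exists x|exists z]; exact: gN.
  by exists u; rewrite gN.
- apply/fibres_connectedP => U clU.
  have xyU : (x \in U) = (y \in U).
    by apply/idP/idP => h; apply: (clU _ _ h); rewrite ?gN // rC.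
  have outX u : u \notin A -> f u = f x -> (x \in U) = (u \in U).
    have K (U' : {set V}) : (forall u v, u \in U' -> r u v -> g u = g v -> v \in U') ->
        x \in U' -> forall u, u \notin A -> f u = f x -> u \in U'.
      move=> clU' xU' v vA fv.
      have xyU' : y \in U' by apply: (clU' x) => //; rewrite !gN.
      suff : v \in [set w | (f w == f x) && ((w \in A) || (w \in U'))].
        by rewrite inE (negPf vA) => /andP[].
      apply: (con _ _ x v) => //; last by rewrite inE eqxx xU' orbT.
      move=> a b; rewrite !inE => /andP[/eqP fa ab] rab fab.
      rewrite -fab fa eqxx /=; case: (boolP (b \in A)) => //= bA.
      case/orP: ab => [aA|aU]; last first.
        case: (boolP (a \in A)) => aA; last by apply: (clU' a); rewrite ?gN.
        case: (cl a b aA rab) => [|->|->|E] //; first by rewrite (negPf bA).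
        by case: fxz; rewrite -fa fab E.
      case: (cl a b aA rab) => [|->|->|E] //; first by rewrite (negPf bA).
      by case: fxz; rewrite -fa fab E.
    move=> uA fu; apply/idP/idP => h; first exact: K h _ _ _.
    apply: contraLR h => xU.
    rewrite -in_setC; apply: (K (~: U)) => //; last by rewrite in_setC.
    move=> a b; rewrite !in_setC => aU rab gab; apply: contra aU => bU.
    by apply: (clU b); rewrite 1?rC.
  have outZ u : u \notin A -> f u = f z -> (z \in U) = (u \in U).
    have K (U' : {set V}) : (forall u v, u \in U' -> r u v -> g u = g v -> v \in U') ->
        z \in U' -> forall u, u \notin A -> f u = f z -> u \in U'.
      move=> clU' zU' v vA fv.
      suff : v \in [set w | (f w == f z) && ((w \in A) || (w \in U'))].
        by rewrite inE (negPf vA) => /andP[].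
      apply: (con _ _ z v) => //; last by rewrite inE eqxx zU' orbT.
      move=> a b; rewrite !inE => /andP[/eqP fa ab] rab fab.
      rewrite -fab fa eqxx /=; case: (boolP (b \in A)) => //= bA.
      case/orP: ab => [aA|aU]; last first.
        case: (boolP (a \in A)) => aA; last by apply: (clU' a); rewrite ?gN.
        case: (cl a b aA rab) => [|E|E|->] //; first by rewrite (negPf bA).
          by case: fxz; rewrite -fa fab E.
        by case: fxz; rewrite -fa fab E.
      case: (cl a b aA rab) => [|E|E|->] //; first by rewrite (negPf bA).
        by case: fxz; rewrite -fa fab E.
      by case: fxz; rewrite -fa fab E.
    move=> uA fu; apply/idP/idP => h; first exact: K h _ _ _.
    apply: contraLR h => zU.
    rewrite -in_setC; apply: (K (~: U)) => //; last by rewrite in_setC.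
    move=> a b; rewrite !in_setC => aU rab gab; apply: contra aU => bU.
    by apply: (clU b); rewrite 1?rC.
  have inA t u : t \in [set x; y; z] -> f t = c -> u \in A -> (t \in U) = (u \in U).
    have K (U' : {set V}) : (forall u v, u \in U' -> r u v -> g u = g v -> v \in U') ->
        t \in [set x; y; z] -> f t = c -> t \in U' -> forall u, u \in A -> u \in U'.
      move=> clU' tS ft tU' v vA; case: (boolP (v \in U')) => // vU'; exfalso.
      have tA : t \notin A by move: tS; rewrite !inE => /orP[/orP[]|] /eqP ->.
      have clv a b : a \in A :\: U' -> r a b -> b \notin A :\: U' ->
          [/\ b \in [set x; y; z] & b <> t].
        rewrite !inE => /andP[aU aA] rab bU.
        have bt : b <> t.
          move=> bt; case/negP: aU; apply: (clU' b); rewrite ?bt 1?rC //; first by rewrite -bt.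
          by rewrite gN // gA.
        have bA : b \notin A.
          apply/negP => bA; move: bU; rewrite bA andbT negbK => bU.
          by case/negP: aU; apply: (clU' b); rewrite 1?rC // !gA.
        split=> //; case: (cl a b aA rab) => [|->|->|->]; rewrite ?eqxx ?orbT //.
        by rewrite (negPf bA).
      have vin : v \in A :\: U' by rewrite inE vA vU'.
      have tout : t \notin A :\: U' by rewrite inE tU'.
      move: tS; rewrite !inE => /orP[/orP[]|] /eqP tE; subst t.
      - apply: (@no_small_cut _ _ r3 y z v d (A :\: U')) => //; last by rewrite inE (negPf dA) andbF.
        move=> a b aA rab bA; case: (clv a b aA rab bA).
        by rewrite !inE => /orP[/orP[]|] /eqP; auto.
      - apply: (@no_small_cut _ _ r3 x z v d (A :\: U')) => //; last by rewrite inE (negPf dA) andbF.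
        move=> a b aA rab bA; case: (clv a b aA rab bA).
        by rewrite !inE => /orP[/orP[]|] /eqP; auto.
      - apply: (@no_small_cut _ _ r3 x y v d (A :\: U')) => //; last by rewrite inE (negPf dA) andbF.
        move=> a b aA rab bA; case: (clv a b aA rab bA).
        by rewrite !inE => /orP[/orP[]|] /eqP; auto.
    move=> tS ft uA; apply/idP/idP => h; first exact: (K U).
    apply: contraLR h => tU.
    rewrite -in_setC; apply: (K (~: U)) => //; last by rewrite in_setC.
    move=> a b; rewrite !in_setC => aU rab gab; apply: contra aU => bU.
    by apply: (clU b); rewrite 1?rC.
  have inAc u v : u \in A -> v \notin A -> f v = c -> (u \in U) = (v \in U).
    move=> uA vA fv; case: cE => cE.
      rewrite -(inA x u) ?inE ?eqxx //; apply: outX => //; exact: etrans fv cE.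
    rewrite -(inA z u) ?inE ?eqxx ?orbT //; apply: outZ => //; exact: etrans fv cE.
  move=> u v uU; case: (boolP (u \in A)) => uA; case: (boolP (v \in A)) => vA.
  - move=> _; case: cE => cE.
      by rewrite -(inA x v) ?(inA x u) ?inE ?eqxx.
    by rewrite -(inA z v) ?(inA z u) ?inE ?eqxx ?orbT.
  - by rewrite gA // gN // => cv; rewrite -(inAc u v).
  - by rewrite gN // gA // => cv; rewrite (inAc v u).
  - rewrite !gN // => fuv.
    case: (eqVneq (f u) (f x)) => fux.
      by rewrite -(outX v) -?fuv // (outX u).
    case: (eqVneq (f u) (f z)) => fuz.
      by rewrite -(outZ v) -?fuv // (outZ u).
    suff : v \in [set w in U | f w == f u] by rewrite inE => /andP[].
    apply: (con _ _ u v) => //; last by rewrite inE uU eqxx.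
      move=> a b; rewrite !inE => /andP[aU /eqP fa] rab fab.
      rewrite -fab fa eqxx andbT.
      have nA w : f w = f u -> w \notin A.
        move=> fw; apply/negP => /fA; rewrite fw => -[] /eqP; first by rewrite (negPf fux).
        by rewrite (negPf fuz).
      by apply: (clU a) => //; rewrite !gN // nA // -fab.
- have xz : exists u v, [/\ g u = f x, g v = f z & r u v].
    case: cE => cE.
      by have [|a aA rza] := adj z; [auto|exists a, z; rewrite (gA a) ?gN 1?rC].
    by have [|a aA rxa] := adj x; [auto|exists x, a; rewrite (gA a) ?gN].
  have zx : exists u v, [/\ g u = f z, g v = f x & r u v].
    by have [u [v [gu gv ruv]]] := xz; exists v, u; rewrite rC.
  have near u v : u \in A -> r u v -> f v = f x \/ f v = f z.
    move=> uA ruv; case: (cl u v uA ruv) => [/fA|->|->|->] //; rewrite -?fxy; auto.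
  move=> a b rab; have [u [v [fu fv ruv]]] := e a b rab.
  have fNE : f u <> f v by move=> E; move: rab; rewrite -fu -fv E rTI.
  have close : u \in A \/ v \in A ->
      (f u = f x \/ f u = f z) /\ (f v = f x \/ f v = f z).
    case=> [uA|vA]; first by split; [exact: fA|exact: near ruv].
    by split; [apply: near vA _; rewrite rC|exact: fA].
  case: (boolP (u \in A)) => uA; last case: (boolP (v \in A)) => vA.
  + rewrite -fu -fv; have [|[U|U] [W|W]] := close; auto; rewrite ?U ?W //.
    * by case: fNE; rewrite U W.
    * by case: fNE; rewrite U W.
  + rewrite -fu -fv; have [|[U|U] [W|W]] := close; auto; rewrite ?U ?W //.
    * by case: fNE; rewrite U W.
    * by case: fNE; rewrite U W.
  by exists u, v; rewrite !gN.
Qed.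

Lemma minor_map_adj (f : V -> T) u v : minor_map f -> f u = f v -> r u v ->
  contractible_minor u v.
Proof. by move=> mf fuv ruv; apply/contractible_minorP; split=> //; exists f. Qed.

Lemma free_reassign (f : V -> T) x y z (A : {set V}) :
  minor_map f -> f x = f y -> r x y -> separates r [set x; y; z] A ->
  (forall u, u \in A -> f u = f x \/ f u = f z) -> free A.
Proof.
move=> mf fxy rxy sA fA u v uA ruv.
have /separates3P[_ [xA yA zA] _ cl] := sA.
case: (eqVneq (f x) (f z)) => [fxz|/eqP fxz].
  have fE w : w \in A -> f w = f x by move=> /fA[]; rewrite -?fxz.
  apply: (minor_map_adj mf) => //; rewrite (fE u uA).
  by case: (cl u v uA ruv) => [/fE|->|->|->].
have m1 := minor_map_reassign mf fxy rxy sA fA fxz (or_introl erefl).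
have m2 := minor_map_reassign mf fxy rxy sA fA fxz (or_intror erefl).
case: (cl u v uA ruv) => [vA|E|E|E].
- by apply: (minor_map_adj m1) => //; rewrite uA vA.
- by apply: (minor_map_adj m1) => //; rewrite uA E (negPf xA).
- by apply: (minor_map_adj m1) => //; rewrite uA E (negPf yA).
- by apply: (minor_map_adj m2) => //; rewrite uA E (negPf zA).
Qed.

(* A fibre other than those of x and z lies on one side of the cut; were there
   such fibres on both sides, f x and f z would separate them in rT. *)
Lemma minor_map_side (f : V -> T) x y z (A : {set V}) :
  minor_map f -> f x = f y -> separates r [set x; y; z] A ->
  (exists2 u, u \in A & f u <> f x /\ f u <> f z) ->
  forall h, [\/ h = f x, h = f z | exists2 u, u \in A & f u = h].
Proof.
move=> /minor_mapP[s /fibres_connectedP con e] fxy sA [a aA [ax az]] h.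
have /separates3P[_ [xA yA zA] _ cl] := sA.
case: (eqVneq h (f x)) => [|hx]; first by move->; exact: Or31.
case: (eqVneq h (f z)) => [|hz]; first by move->; exact: Or32.
apply: Or33; case: (boolP [exists u in A, f u == h]) => [/exists_inP[u uA /eqP]|nh].
  by exists u.
exfalso; pose B := [set k | [&& k != f x, k != f z & [exists u in A, f u == k]]].
apply: (@no_small_cut _ _ rT3 (f x) (f z) (f a) h B).
- move=> k l; rewrite inE => /and3P[/eqP kx /eqP kz /exists_inP[u uA /eqP fu]] rkl.
  have fibA w : f w = k -> w \in A.
    move=> fw; suff : w \in [set v in A | f v == k] by rewrite inE => /andP[].
    apply: (con _ _ u w); rewrite ?inE ?uA ?fu ?eqxx // => p q.
    rewrite !inE => /andP[pA /eqP fp] rpq fpq; rewrite -fpq fp eqxx andbT.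
    case: (cl p q pA rpq) => // E; [case: kx|case: kx|case: kz]; rewrite -fp fpq E //.
  have [p [q [fp fq rpq]]] := e k l rkl.
  rewrite inE => lB; case: (eqVneq l (f x)) => [|lx]; first by left.
  case: (eqVneq l (f z)) => [|lz]; first by right.
  exfalso; case: (cl p q (fibA p fp) rpq) => [qA|E|E|E].
  + by case/negP: lB; rewrite lx lz; apply/exists_inP; exists q; rewrite ?fq.
  + by rewrite -fq E eqxx in lx.
  + by rewrite -fq E -fxy eqxx in lx.
  + by rewrite -fq E eqxx in lz.
- rewrite inE; apply/and3P; split; try exact/eqP.
  by apply/exists_inP; exists a.
- by rewrite inE hx hz.
- exact/eqP.
- exact/eqP.
Qed.

Lemma noncontractible3_free x y :
  contractible_minor x y -> ~~ contractible3 r x y ->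
  exists z (A : {set V}), separates r [set x; y; z] A /\ free A.
Proof.
move=> /contractible_minorP[rxy [f mf fxy]] /contractible3PnE[z [A sA]].
exists z.
case: (boolP [exists u in A, (f u != f x) && (f u != f z)]) => [|nA].
  move=> /exists_inP[u uA /andP[/eqP ux /eqP uz]].
  exists (~: (A :|: [set x; y; z])); split; first exact: separatesC.
  apply: (free_reassign mf fxy rxy (separatesC rC sA)) => v vA'.
  case: (eqVneq (f v) (f x)) => [|/eqP vx]; first by left.
  case: (eqVneq (f v) (f z)) => [|/eqP vz]; first by right.
  exfalso.
  have [E|E|[w wA wv]] := minor_map_side mf fxy sA (ex_intro2 _ _ u uA (conj ux uz)) (f v);
    [by case: vx|by case: vz|].
  have /minor_mapP[_ /fibres_connectedP con _] := mf.
  have : v \in [set p in A | f p == f v].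
    apply: (con _ _ w v); rewrite ?inE ?wA ?wv ?eqxx // => p q.
    rewrite !inE => /andP[pA /eqP fp] rpq fpq; rewrite -fpq fp eqxx andbT.
    have /separates3P[_ _ _ cl] := sA.
    by case: (cl p q pA rpq) => // E; [case: vx|case: vx|case: vz]; rewrite -fp fpq E.
  by rewrite inE => /andP[vA]; move: vA'; rewrite !inE vA.
exists A; split=> //; apply: (free_reassign mf fxy rxy sA) => u uA.
move: nA; rewrite negb_exists_in => /forall_inP/(_ u uA).
by rewrite negb_and !negbK => /orP[]/eqP; auto.
Qed.

(* The case where {x} is a whole fibre forces #|T| <= 3, and a model is then
   built by hand, with y as a singleton fibre. *)
Lemma contractible_minor_third x w y s :
  contractible_minor w y -> separates r [set w; y; s] [set x] ->
  contractible3 r x s -> r x s -> contractible_minor x s.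
Proof.
move=> /contractible_minorP[rwy [f mf fwy]] sx c3 rxs.
have /separates3P[_ [wx yx sx'] _ cl] := sx.
case: (boolP ((f x == f w) || (f x == f s))) => [fx|].
  apply: (free_reassign mf fwy rwy sx) => //; last by rewrite inE.
  by move=> u; rewrite inE => /eqP->; case/orP: fx => /eqP; auto.
rewrite negb_or => /andP[/eqP fxw /eqP fxs].
have hE h : [\/ h = f w, h = f s | h = f x].
  have [|->|->|[u]] := minor_map_side mf fwy sx _ h.
  - by exists x; rewrite ?inE.
  - exact: Or31.
  - exact: Or32.
  - by rewrite inE => /eqP-> <-; exact: Or33.
pose g v := if v == y then f x else if (v == x) || (v == s) then f s else f w.
have [wNy wNs yNs] := separates_neq r3 sx.
have [wNx yNx sNx] : [/\ w != x, y != x & s != x] by move: wx yx sx'; rewrite !inE.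
have adjx v : v \in [set w; y; s] -> r x v.
  have adj p q t : (forall v, v \in [set w; y; s] -> [\/ v = p, v = q | v = t]) ->
      p \in [set w; y; s] -> q \in [set w; y; s] -> r x t.
    move=> h pS qS; have [a] := @separates_adj _ _ rC r3 _ _ p q t sx h pS qS.
    by rewrite inE => /eqP->; rewrite rC.
  rewrite !inE => /orP[/orP[]|] /eqP->.
  - apply: (adj y s); rewrite ?inE ?eqxx ?orbT // => t.
    by rewrite !inE => /orP[/orP[]|] /eqP; [exact: Or33|exact: Or31|exact: Or32].
  - apply: (adj w s); rewrite ?inE ?eqxx ?orbT // => t.
    by rewrite !inE => /orP[/orP[]|] /eqP; [exact: Or31|exact: Or33|exact: Or32].
  - exact: rxs.
have rxw : r x w by apply: adjx; rewrite !inE eqxx.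
have rxy : r x y by apply: adjx; rewrite !inE eqxx orbT.
have gy : g y = f x by rewrite /g eqxx.
have gx : g x = f s by rewrite /g eq_sym (negPf yNx) eqxx.
have gs : g s = f s by rewrite /g eq_sym (negPf yNs) eqxx orbT.
have gw : g w = f w by rewrite /g (negPf wNy) (negPf wNx) (negPf wNs).
have mg : minor_map g.
  apply/minor_mapP; split.
  - by move=> h; case: (hE h) => ->; [exists w|exists s|exists y].
  - apply/fibres_connectedP => U clU u v uU guv.
    case: (boolP (v \in U)) => // vU; exfalso.
    pose B := [set t in U | g t == g u].
    have uB : u \in B by rewrite inE uU eqxx.
    have vB : v \notin B by rewrite inE negb_and vU.
    have clB p q : p \in B -> r p q -> q \notin B -> g q <> g u.
      rewrite !inE => /andP[pU /eqP gp] rpq qB gq; case/negP: qB.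
      by rewrite gq eqxx andbT; apply: (clU p); rewrite // gp gq.
    have uv : u <> v by move=> E; rewrite -E uU in vU.
    have gEy t : g t = f x -> t = y.
      rewrite /g; case: (eqVneq t y) => // _; case: ifP => _ E; first by case: fxs.
      by case: fxw.
    case: (eqVneq (g u) (f x)) => [gu|/eqP gux].
      by case: uv; rewrite (gEy u gu) (gEy v) // -guv.
    case: (eqVneq (f w) (f s)) => [fws|/eqP fws].
      have gE t : t != y -> g t = f s by move=> ty; rewrite /g (negPf ty) fws if_same.
      have gu : g u = f s.
        by apply: gE; apply/eqP => E; case: gux; rewrite E.
      apply: (@no_small_cut _ _ r3 y y u v B) => //.
      + move=> p q pB rpq qB; left; apply/eqP; apply: contraT => qy.
        by case: (clB p q pB rpq qB); rewrite gE.
      + by move=> E; case: gux; rewrite guv E.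
      + by move=> E; case: gux; rewrite guv E.
    have gxs t : g t = f s -> t = x \/ t = s.
      rewrite /g; case: (eqVneq t y) => [_ E|ty]; first by case: fxs.
      by case: (eqVneq t x) => [|_] /=; [left|case: (eqVneq t s) => [|_ /fws]; [right|]].
    case: (eqVneq (g u) (f s)) => [gu|/eqP gus].
      have xsB : (x \in B) = (s \in B).
        apply/idP/idP => h; apply: contraT => nB.
          by case: (clB x s h rxs nB); rewrite gs gu.
        by case: (clB s x h _ nB); rewrite ?gx // rC.
      have gv : g v = f s by rewrite -guv.
      move: uB vB.
      by case: (gxs u gu) => ->; case: (gxs v gv) => ->; rewrite ?xsB => ->.
    have gwE t : t != x -> t != y -> t != s -> g t = f w.
      by rewrite /g => /negPf-> /negPf-> /negPf->.
    have neq t : g t = g u -> [/\ t != x, t != y & t != s].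
      move=> gt; split; apply/eqP => E; rewrite E in gt.
      + by case: gus; rewrite -gt.
      + by case: gux; rewrite -gt.
      + by case: gus; rewrite -gt.
    have gu : g u = f w by have [] := neq u erefl; exact: gwE.
    move/forallP/(_ y)/forallP/(_ B)/negP: c3; apply; apply/separates3P; split.
    + by exists u.
    + split; rewrite inE negb_and gu; apply/orP; right; apply/eqP.
      * by rewrite gx; exact: nesym.
      * by rewrite gs; exact: nesym.
      * by rewrite gy.
    + by exists v; have [/eqP ? /eqP ? /eqP ?] := neq v (esym guv).
    + move=> p q pB rpq; case: (boolP (q \in B)) => qB; first exact: Or41.
      case: (eqVneq q x) => [|qx]; first exact: Or42.
      case: (eqVneq q s) => [|qs]; first exact: Or43.
      case: (eqVneq q y) => [|qy]; first exact: Or44.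
      by case: (clB p q pB rpq qB); rewrite gwE.
  - move=> h k rhk.
    have hk : h <> k by move=> E; move: rhk; rewrite E rTI.
    case: (hE h) => Eh; case: (hE k) => Ek; subst h k; try by case: hk.
    + by exists w, x; rewrite gw gx rC.
    + by exists w, y; rewrite gw gy.
    + by exists x, w; rewrite gw gx.
    + by exists x, y; rewrite gx gy.
    + by exists y, w; rewrite gw gy rC.
    + by exists y, x; rewrite gx gy rC.
by apply: (minor_map_adj mg) => //; rewrite gx gs.
Qed.

End MinorMaps.

(** * Counting components of good edges *)

Section Counting.

Variables (V T : finType) (r : rel V) (rT : rel T).
Hypotheses (rC : symmetric r) (rI : irreflexive r) (r3 : connected3 r).
Hypotheses (rTI : irreflexive rT) (rT3 : connected3 rT).

Notation cminor := (contractible_minor r rT).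

Definition good : rel V := fun x y => cminor x y && contractible3 r x y.

Definition isolated : {set V} := [set x | [forall y, ~~ good x y]].

Lemma isolatedP x : reflect (forall y, ~~ good x y) (x \in isolated).
Proof. by rewrite inE; exact: forallP. Qed.

(* For isolated x, w has degree three and its two edges other than wx are good. *)
Definition spoke (x w : V) : bool :=
  cminor x w &&
  [exists a, exists b, [&& a != b, good w a, good w b &
     [forall v, r w v ==> (v \in [set x; a; b])]]].

Lemma goodC : symmetric good.
Proof. by move=> x y; rewrite /good contractible_minorC // contractible3C. Qed.

Lemma good_adj x y : good x y -> r x y.
Proof. by case/andP => /contractible_minorP[]. Qed.

Lemma isolated_free_spoke x y z (C : {set V}) :
  x \in isolated -> cminor x y -> separates r [set x; y; z] C -> free r rT C ->
  exists2 w, w \in C & spoke x w.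
Proof.
move=> /isolatedP xI; have [n] := ubnP #|C|; elim: n y z C => // n IH y z C.
rewrite ltnS => Cn xy sC fC.
have xu_bad u : cminor x u -> ~~ contractible3 r x u.
  by move=> xu; have := xI u; rewrite /good xu.
have rxy : r x y by have /contractible_minorP[] := xy.
have mem3 p t : r x p ->
  forall v, v \in [set x; p; t] -> [\/ v = x, v = p | v = t].
  by move=> _ v; rewrite !inE => /orP[/orP[]|]/eqP; [exact: Or31|exact: Or32|exact: Or33].
have [u uC rxu] : exists2 u, u \in C & r x u.
  apply: (@separates_adj _ _ rC r3 _ _ y z x sC); rewrite ?inE ?eqxx ?orbT //.
  by move=> v /(mem3 y z rxy)[]; [exact: Or33|exact: Or31|exact: Or32].
have xu : cminor x u by rewrite contractible_minorC //; apply: fC => //; rewrite rC.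
have [t [P sP]] := contractible3PnE (xu_bad u xu).
have [Cu|[q [C' [sC' C'C uC']]]] := separates_descent rC r3 sC uC sP; last first.
  have [||w wC' xw] := IH u q C' _ xu sC'.
  - apply: leq_trans (proper_card _) Cn; apply/properP; split=> //.
    by exists u.
  - by move=> a b aC'; apply: fC; apply: (subsetP C'C).
  by exists w => //; apply: (subsetP C'C).
exists u => //; rewrite /spoke xu /=.
have /separates3P[_ _ _ cl] := sC.
have Nu v : r u v -> [\/ v = x, v = y | v = z].
  move=> ruv; case: (cl u v uC ruv); [|exact: Or31|exact: Or32|exact: Or33].
  by rewrite Cu inE => /eqP E; move: ruv; rewrite E rI.
have nbr v : v \in [set x; y; z] -> r u v.
  have adj p q w : (forall v, v \in [set x; y; z] -> [\/ v = p, v = q | v = w]) ->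
      p \in [set x; y; z] -> q \in [set x; y; z] -> r u w.
    move=> h pS qS; have [a] := @separates_adj _ _ rC r3 _ _ p q w sC h pS qS.
    by rewrite Cu inE => /eqP->; rewrite rC.
  rewrite !inE => /orP[/orP[]|] /eqP->.
  - by rewrite rC.
  - apply: (adj x z); rewrite ?inE ?eqxx ?orbT // => v'.
    by move=> /(mem3 y z rxy)[]; [exact: Or31|exact: Or33|exact: Or32].
  - apply: (adj x y); rewrite ?inE ?eqxx ?orbT // => v'.
    by move=> /(mem3 y z rxy).
have ruy : r u y by apply: nbr; rewrite !inE eqxx orbT.
have ruz : r u z by apply: nbr; rewrite !inE eqxx orbT.
have gz : good u z.
  by rewrite /good fC //=; apply: contractible3_third rxy Nu.
have gy : good u y.
  rewrite /good fC //=; apply: contraT => /contractible3PnE[t' [X sX]].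
  have ux : ~~ contractible3 r u x by rewrite contractible3C xu_bad.
  have [t2 [Y sY]] := contractible3PnE ux.
  have Nx := separates_uncross rC rI r3 rxy Nu sY sX.
  have [uy ut' yt'] := separates_neq r3 sX.
  have [xy' xz yz] := separates_neq r3 sC.
  have xNu : x != u by apply/eqP => E; move: rxu; rewrite E rI.
  have zNu : z <> u by move=> E; move: ruz; rewrite E rI.
  have t'x : t' != x.
    apply/eqP => E; apply: (@no_small_cut _ _ r3 u y x z [set x]); rewrite ?inE //.
    - move=> a b; rewrite inE => /eqP-> rxb _.
      case: (Nx b rxb); auto => Eb; first by move: rxb; rewrite Eb E rI.
    - by rewrite eq_sym.
    - by move=> Ez; rewrite Ez eqxx in yz.
  have sx : separates r [set u; y; t'] [set x].
    have /separates3P[[a aX] [uX yX t'X] [b [bX bu bY bt']] _] := sX.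
    apply/separates3P; split; first by exists x; rewrite inE.
    - by rewrite !inE; split; rewrite // eq_sym.
    - case: (eqVneq b x) => bx; last by exists b; rewrite inE.
      exists a; rewrite inE; split.
      + by apply/eqP => ax; rewrite bx -ax aX in bX.
      + by move=> E; rewrite -E aX in uX.
      + by move=> E; rewrite -E aX in yX.
      + by move=> E; rewrite -E aX in t'X.
    - by move=> a' b'; rewrite inE => /eqP-> /Nx[]; [exact: Or42|exact: Or43|exact: Or44].
  have rxt' : r x t'.
    have [|||a] := @separates_adj _ _ rC r3 _ _ u y t' sx; rewrite ?inE ?eqxx ?orbT //.
      by move=> v'; rewrite !inE => /orP[/orP[]|]/eqP; [exact: Or31|exact: Or32|exact: Or33].
    by move=> /eqP->; rewrite rC.
  have c3 : contractible3 r x t' by apply: contractible3_third ruy Nx.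
  have := xI t'; rewrite /good c3 andbT => /negP; case.
  by apply: contractible_minor_third sx c3 rxt' => //; apply: fC.
apply/existsP; exists y; apply/existsP; exists z; rewrite gy gz.
have [_ _ ->] := separates_neq r3 sC.
by apply/forallP => v; apply/implyP => /Nu[]->; rewrite !inE eqxx ?orbT.
Qed.

Lemma isolated_two_spokes x y : x \in isolated -> cminor x y ->
  exists w1 w2, [/\ w1 != w2, spoke x w1 & spoke x w2].
Proof.
move=> xI xy; have bad v : cminor x v -> ~~ contractible3 r x v.
  by move=> xv; move/isolatedP/(_ v): xI; rewrite /good xv.
have [z [C [sC fC]]] := noncontractible3_free rC r3 rTI rT3 xy (bad y xy).
have [w wC xw] := isolated_free_spoke xI xy sC fC.
have xw' : cminor x w by case/andP: xw.
have [z2 [C2 [sC2 fC2]]] := noncontractible3_free rC r3 rTI rT3 xw' (bad w xw').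
have [w2 w2C xw2] := isolated_free_spoke xI xw' sC2 fC2.
exists w, w2; split=> //; apply/eqP => E.
by have /separates3P[_ [_ wC2 _] _ _] := sC2; rewrite E w2C in wC2.
Qed.

Lemma spoke_uniq x x' w : x' \in isolated -> spoke x w -> spoke x' w -> x = x'.
Proof.
move=> /isolatedP x'I /andP[_ /existsP[a /existsP[b]]].
move=> /and4P[_ wa wb /forallP N] /andP[/contractible_minorP[rxw _] _].
move/implyP/(_ _): (N x'); rewrite rC => /(_ rxw); rewrite !inE => /orP[/orP[/eqP->//|]|] /eqP E.
  by have := x'I w; rewrite E goodC wa.
by have := x'I w; rewrite E goodC wb.
Qed.

Definition spokes : {set V} := [set w | [exists x in isolated, spoke x w]].

Definition uncovered : {set V} := [set x | [forall y, ~~ cminor x y]].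

Lemma card_spokes : #|isolated :\: uncovered| * 2 <= #|spokes|.
Proof.
pose p w := odflt w [pick x in isolated | spoke x w].
have pE x w : x \in isolated -> spoke x w -> p w = x.
  move=> xI xw; rewrite /p; case: pickP => [y /andP[yI yw]|/(_ x)] /=; last by rewrite xI xw.
  exact: spoke_uniq xI yw xw.
rewrite -[#|spokes|]sum1_card (partition_big p (mem (isolated :\: uncovered))) /=.
  rewrite -sum_nat_const; apply: leq_sum => x; rewrite inE => /andP[].
  rewrite inE negb_forall => /existsP[y /negPn xy] xI.
  rewrite sum1_card; apply/card_gt1P.
  have [w1 [w2 [w12 xw1 xw2]]] := isolated_two_spokes xI xy.
  have inS w : spoke x w -> w \in [pred i | (i \in spokes) && (p i == x)].
    move=> xw; rewrite inE (pE x) // eqxx andbT inE.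
    by apply/existsP; exists x; rewrite xI.
  by exists w1, w2; split=> //; exact: inS.
move=> w; rewrite inE => /exists_inP[x xI xw]; rewrite (pE x) // inE xI andbT inE.
by rewrite negb_forall; apply/existsP; exists w; case/andP: xw => ->.
Qed.

Lemma card_uncovered (f : V -> T) : minor_map r rT f -> #|T| < #|V| ->
  #|uncovered| < #|T|.
Proof.
move=> mf ltTV; have /minor_mapP[_ /fibres_connectedP con _] := mf.
have cov u v : u != v -> f u = f v -> u \notin uncovered.
  move=> uv fuv; rewrite inE negb_forall.
  case: (boolP [exists w, r u w && (f u == f w)]) => [/existsP[w /andP[ruw /eqP fuw]]|].
    apply/existsP; exists w; rewrite negbK.
    by apply: (minor_map_adj mf).
  rewrite negb_exists => /forallP n; have : v \in [set u].
    apply: (con _ _ u v); rewrite ?inE // => a b; rewrite inE => /eqP-> rub fub.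
    by have := n b; rewrite rub fub eqxx.
  by rewrite inE eq_sym (negPf uv).
have inj : {in uncovered &, injective f}.
  move=> u v uU _ fuv; apply/eqP; apply: contraTT uU => uv; exact: cov fuv.
have /injectivePn[p [q pq fpq]] : ~~ injectiveb f.
  by apply/negP => /injectiveP/leq_card; rewrite leqNgt ltTV.
rewrite -(card_in_imset inj) -cardsT; apply: proper_card.
rewrite properE subsetT /=; apply/subsetPn; exists (f p); rewrite ?inE //.
apply/imsetP => -[u uU fpu]; case: (eqVneq u p) => up.
  by have := cov p q pq fpq; rewrite -up uU.
by have := cov u p up (esym fpu); rewrite uU.
Qed.

Definition blocks := equivalence_partition (connect good) [set: V].

Lemma blocks_partition : partition blocks [set: V].
Proof.
apply/equivalence_partitionP => x y z _ _ _; split; first exact: connect0.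
by move=> xy; apply: same_connect xy _; exact: sym_connect_sym goodC.
Qed.

Lemma card_gt4_noncontractible x y : ~~ contractible3 r x y -> 4 < #|V|.
Proof.
move=> /contractible3PnE[z [P sP]].
have [xy xz yz] := separates_neq r3 sP.
have /separates3P[[a aP] [xP yP zP] [b [bP /eqP bx /eqP bY /eqP bz]] _] := sP.
have ne v : v \notin P -> a != v by apply: contra => /eqP <-.
suff U : uniq [:: b; a; x; y; z].
  by rewrite -[5]/(size [:: b; a; x; y; z]) -(card_uniqP U) max_card.
by rewrite /= !inE !negb_or bx bY bz !ne // eq_sym ne // xy xz yz.
Qed.

Lemma block_bound (A : {set V}) : A \in blocks ->
  4 + #|A :&: spokes| <= #|A| * 2 + #|A :&: isolated| * 2.
Proof.
move=> /imsetP[x _ ->]; set B := [set _ in _ | _].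
have xB : x \in B by rewrite !inE connect0.
have clB a b : a \in B -> good a b -> b \in B.
  by rewrite !inE /= => xa ab; apply: connect_trans xa (connect1 ab).
have Bx : x \in isolated -> B = [set x].
  move=> /isolatedP xI; apply/setP => y; rewrite !inE /=.
  apply/connectP/eqP => [[[|z p] /= pth ->] //|->]; last by exists [::].
  by move: pth; rewrite (negPf (xI z)).
clearbody B.
have spokeE w : w \in spokes -> exists x0 a b, [/\ a != b, good w a, good w b,
    (forall v, r w v -> [\/ v = x0, v = a | v = b]) & ~~ contractible3 r x0 w].
  rewrite inE => /exists_inP[x0 /isolatedP x0I /andP[x0w]].
  move=> /existsP[a /existsP[b /and4P[ab wa wb /forallP N]]].
  exists x0, a, b; split=> //; last by have := x0I w; rewrite /good x0w.
  move=> v rwv; have /implyP/(_ rwv) := N v.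
  by rewrite !inE => /orP[/orP[]|] /eqP; [exact: Or31|exact: Or32|exact: Or33].
have gN u v : good u v -> u != v.
  by move=> /good_adj ruv; apply: contraTneq ruv => ->; rewrite rI.
have spoke3 w : w \in B -> w \in spokes -> exists x0 a b,
    [/\ [/\ a != b, w != a & w != b], [set w; a; b] \subset B, good w a /\ good w b,
    (forall v, r w v -> [\/ v = x0, v = a | v = b]) & ~~ contractible3 r x0 w].
  move=> wB /spokeE[x0 [a [b [ab wa wb N c3]]]]; exists x0, a, b; split=> //.
    by rewrite ab (gN _ _ wa) (gN _ _ wb).
  apply/subsetP => v; rewrite !inE => /orP[/orP[]|] /eqP -> //.
    exact: clB wa.
  exact: clB wb.
have card3 (a b c : V) : [/\ b != c, a != b & a != c] -> #|[set a; b; c]| = 3.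
  by move=> [bc ab ac]; rewrite -setUA cardsU1 cards2 !inE bc negb_or ab ac.
have leI : #|B :&: spokes| <= #|B| by rewrite subset_leq_card ?subsetIl.
case: (boolP (x \in isolated)) => xI.
  have nS : B :&: spokes = set0.
    apply/setP => v; rewrite in_set0; apply/negP; rewrite inE Bx // in_set1.
    move=> /andP[/eqP-> /spokeE[_ [a [_ [_ xa _ _ _]]]]].
    by move/isolatedP/(_ a): xI; rewrite xa.
  by rewrite nS Bx // (setIidPl _) ?sub1set // cards0 cards1.
have B2 : 1 < #|B|.
  move: xI; rewrite inE negb_forall => /existsP[y /negPn xy].
  by apply/card_gt1P; exists x, y; split=> //; [exact: clB xy|exact: gN].
case: (set_0Vmem (B :&: spokes)) => [->|[w]]; first by rewrite cards0; lia.
rewrite inE => /andP[wB wS].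
have [x0 [a [b [d3 sB [wa wb] N c3]]]] := spoke3 w wB wS.
have B3 : 2 < #|B| by rewrite -(card3 _ _ _ d3) subset_leq_card.
case: (ltngtP #|B| 3) => [|B4|BE]; [lia|lia|].
case: (ltnP #|B :&: spokes| 3) => S3; first by lia.
exfalso; have BS : B \subset spokes.
  have /eqP <- : B :&: spokes == B by rewrite eqEcard subsetIl BE.
  exact: subsetIr.
have EB : B = [set w; a; b].
  by apply/esym/eqP; rewrite eqEcard sB (card3 _ _ _ d3) BE.
have aB : a \in B by apply: clB wa.
have ab : good a b.
  have [_ [a' [b' [[a'b' aa' ab'] _ [gaa' gab'] _ _]]]] := spoke3 a aB (subsetP BS a aB).
  have := clB a a' aB gaa'; have := clB a b' aB gab'.
  rewrite EB !inE (eq_sym a' a) (eq_sym b' a) (negPf aa') (negPf ab') !orbF.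
  move=> /orP[/eqP E1|/eqP E1] /orP[/eqP E2|/eqP E2]; move: gaa' gab' a'b'; rewrite E1 E2 ?eqxx //.
case/andP: ab => _ /forallP/(_ x0)/forallP/(_ [set w])/negP; apply.
have V5 := card_gt4_noncontractible c3.
have [v vN] : exists v, v \notin [set w; x0; a; b].
  suff /subsetPn[v _ vN] : ~~ ([set: V] \subset [set w; x0; a; b]) by exists v.
  apply/negP => /subset_leq_card; rewrite cardsT leqNgt => /negP; apply.
  apply: leq_ltn_trans V5.
  have sz : size [:: w; x0; a; b] = 4 by [].
  rewrite -sz; apply: leq_trans (card_size _); apply: subset_leq_card.
  by apply/subsetP => v; rewrite !inE -!orbA.
have [dab dwa dwb] := d3.
move: vN; rewrite !inE !negb_or -!andbA => /and4P[vw /eqP vx /eqP va /eqP vb].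
apply/separates3P; split.
- by exists w; rewrite inE.
- rewrite !inE; split; rewrite 1?eq_sym //.
  by have [t [P /(separates_neq r3)[]]] := contractible3PnE c3; rewrite eq_sym.
- by exists v; rewrite inE.
- by move=> p q; rewrite inE => /eqP-> /N[]; [exact: Or44|exact: Or42|exact: Or43].
Qed.

Lemma card_sum_blocks (S : {set V}) : #|S| = \sum_(A in blocks) #|A :&: S|.
Proof.
transitivity (\sum_(x in [set: V]) (x \in S : nat)).
  rewrite -sum1_card big_mkcond [RHS]big_mkcond; apply: eq_bigr => x _.
  by rewrite inE; case: (x \in S).
rewrite (set_partition_big _ blocks_partition) /=; apply: eq_bigr => A _.
rewrite -sum1_card [LHS]big_mkcond [RHS]big_mkcond; apply: eq_bigr => x _.
by rewrite inE; case: (x \in A); case: (x \in S).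
Qed.

Lemma card_blocks (f : V -> T) : minor_map r rT f -> #|T| < #|V| ->
  #|blocks| * 2 < #|V| + #|T|.
Proof.
move=> mf ltTV; have lt := card_uncovered mf ltTV.
have le : \sum_(A in blocks) (4 + #|A :&: spokes|) <=
          \sum_(A in blocks) (#|A :&: setT| * 2 + #|A :&: isolated| * 2).
  by apply: leq_sum => A /block_bound; rewrite setIT.
move: le; rewrite !big_split -!big_distrl /= -!card_sum_blocks sum_nat_const cardsT.
have := card_spokes; have := cardsID uncovered isolated.
have := subset_leq_card (subsetIr isolated uncovered).
move: lt {mf ltTV}; move: #|uncovered| #|_ :&: _| #|_ :\: _| #|isolated| #|spokes|.
by move: #|blocks| #|V| #|T| => *; lia.
Qed.

End Counting.

(** * Multigraphs *)

Definition neighbour (G : mgraph) : rel (vertex G) :=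
  fun x y => (x != y) && adjacent x y.

Lemma adjacentP (G : mgraph) (x y : vertex G) :
  reflect (exists e : edge G, ends e = [set x; y]) (adjacent x y).
Proof. exact: 'exists_eqP. Qed.

Lemma neighbourP (G : mgraph) (x y : vertex G) :
  reflect (x <> y /\ exists e : edge G, ends e = [set x; y]) (neighbour x y).
Proof. by apply: (iffP andP) => -[/eqP ? /adjacentP]. Qed.

Lemma adjacentC (G : mgraph) : symmetric (@adjacent G).
Proof. by move=> x y; rewrite /adjacent setUC. Qed.

Lemma neighbourC (G : mgraph) : symmetric (@neighbour G).
Proof. by move=> x y; rewrite /neighbour eq_sym adjacentC. Qed.

Lemma neighbourI (G : mgraph) : irreflexive (@neighbour G).
Proof. by move=> x; rewrite /neighbour eqxx. Qed.

Lemma connect_stable (T : finType) (e : rel T) (U : {set T}) x y :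
  (forall u v, u \in U -> e u v -> v \in U) -> connect e x y -> x \in U -> y \in U.
Proof.
move=> cl /connectP[p]; elim: p x => [|z p IH] x /=; first by move=> _ ->.
by move=> /andP[xz pth] yE xU; apply: IH pth yE (cl _ _ xU xz).
Qed.

Lemma kconnected3_connected3 (G : mgraph) : kconnected 3 G -> connected3 (@neighbour G).
Proof.
move=> G3 S A S2; apply/negP => /separatesP[[a aA] dA [b [bA bS]] cl].
have aS := dA a aA.
pose a' : vertex (delete_vertices S) := Sub a aS.
pose b' : vertex (delete_vertices S) := Sub b bS.
suff : b' \in [set v : vertex (delete_vertices S) | val v \in A].
  by rewrite inE SubK (negPf bA).
apply: connect_stable (G3 S S2 a' b') _; last by rewrite inE SubK.
move=> u v; rewrite !inE => uA /adjacentP[e eE].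
case: (eqVneq (val u) (val v)) => [<-//|uv].
have ruv : neighbour (val u) (val v).
  apply/neighbourP; split; first exact/eqP.
  exists (val e).
  have in_e w : (w \in ends e) = (val w \in ends (val e)) by rewrite inE.
  apply/eqP; rewrite eq_sym eqEcard.
  have /andP[_ le2] := ends_card (val e); rewrite cards2 uv le2 andbT.
  by apply/subsetP => w; rewrite !inE => /orP[]/eqP->; rewrite -in_e eE !inE eqxx ?orbT.
by apply: contraT => vA; have := cl _ _ uA ruv vA; rewrite (negPf (valP v)).
Qed.

Section ContractMap.

Variables (G : mgraph) (e : edge G).

Lemma contract_mapP (u v : vertex G) :
  contract_map e u = contract_map e v <-> u = v \/ (u \in ends e /\ v \in ends e).
Proof.
split=> [/(congr1 val)|].
  rewrite /= /contract_block; case: ifP => ue; case: ifP => ve; auto.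
  - by move=> /setP/(_ v); rewrite !inE eqxx ve.
  - by move=> /setP/(_ u); rewrite !inE eqxx ue.
  - by move=> /setP/(_ u); rewrite !inE eqxx => /esym/eqP; left.
by case=> [->//|[ue ve]]; apply: val_inj; rewrite /= /contract_block ue ve.
Qed.

Lemma contract_map_surj (t : contract_vertex e) : exists v, contract_map e v = t.
Proof.
have /codomP[v vE] := valP t.
by exists v; apply: val_inj; rewrite /= -vE.
Qed.

Lemma contract_edge_ends (f : edge G) : f != e ->
  exists f' : edge (contract e), ends f' = contract_map e @: ends f.
Proof. by move=> fe; exists (Sub f fe). Qed.

Lemma neighbour_contract (u v : vertex G) : neighbour u v ->
  contract_map e u = contract_map e v \/
  @neighbour (contract e) (contract_map e u) (contract_map e v).
Proof.
move=> /neighbourP[uv [f fE]].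
case: (eqVneq (contract_map e u) (contract_map e v)) => cuv; [by left|right].
apply/neighbourP; split; first exact/eqP.
have fe : f != e.
  apply: contra_neq cuv => fe; apply/contract_mapP; right.
  by rewrite -fe fE !inE !eqxx orbT.
have [f' f'E] := contract_edge_ends fe.
by exists f'; rewrite f'E fE imsetU !imset_set1.
Qed.

Lemma neighbour_ends (u v : vertex G) : u \in ends e -> v \in ends e -> u <> v ->
  ends e = [set u; v].
Proof.
move=> ue ve /eqP uv; apply/esym/eqP; rewrite eqEcard cards2 uv.
have /andP[_ ->] := ends_card e; rewrite andbT.
by apply/subsetP => w; rewrite !inE => /orP[]/eqP->.
Qed.

Lemma contract_kconnected3 x y : connected3 (@neighbour G) -> ends e = [set x; y] ->
  contractible3 (@neighbour G) x y -> kconnected 3 (contract e).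
Proof.
move=> G3 eE c3 X X3 s t.
pose U := [set w | connect (@adjacent (delete_vertices X)) s w].
case: (boolP (t \in U)) => [|tU]; first by rewrite inE.
exfalso.
pose S := [set v | contract_map e v \in X].
pose A := [set v | [exists w in U, val w == contract_map e v]].
have sep : separates (@neighbour G) S A.
  apply/separatesP; split.
  - have [v vE] := contract_map_surj (val s).
    exists v; rewrite inE; apply/exists_inP; exists s; last by rewrite vE.
    by rewrite inE connect0.
  - move=> v; rewrite !inE => /exists_inP[w _ /eqP <-]; exact: (valP w).
  - have [v vE] := contract_map_surj (val t).
    exists v; rewrite !inE vE; split; last exact: (valP t).
    by apply/exists_inP => -[w wU /eqP/val_inj E]; rewrite -E wU in tU.
  - move=> a b; rewrite !inE => /exists_inP[w wU /eqP wE] rab bA.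
    apply: contraT => bX; case/negP: bA; apply/exists_inP.
    case: (neighbour_contract rab) => [ab|/neighbourP[nab [f fE]]].
      by exists w => //; rewrite wE ab.
    pose w' : vertex (delete_vertices X) := Sub (contract_map e b) bX.
    exists w'; last by rewrite SubK.
    rewrite inE in wU; rewrite inE; apply: connect_trans wU (connect1 _).
    have df : [disjoint ends f & X].
      rewrite fE disjoint_subset; apply/subsetP => p; rewrite !inE => /orP[]/eqP-> //.
      by rewrite -wE; exact: (valP w).
    apply/adjacentP; exists (Sub f df); apply/setP => p.
    rewrite inE SubK fE !inE -wE -(inj_eq val_inj p w) -(inj_eq val_inj p w').
    by rewrite SubK.
have [z Sz] : exists z, S \subset [set x; y; z] \/ #|S| <= 2.
  case: (boolP (contract_map e x \in X)) => xX.
    have Xle : #|X :\ contract_map e x| <= 1 by move: X3; rewrite (cardsD1 (contract_map e x)) xX.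
    case: (set_0Vmem (X :\ contract_map e x)) => [X0|[m mX]].
      exists x; left; apply/subsetP => v; rewrite inE => vX.
      have /contract_mapP[->|[]] : contract_map e v = contract_map e x.
        apply/eqP; apply: contraT => vx.
        by have := in_set0 (contract_map e v); rewrite -X0 !inE vx vX.
        by rewrite !inE eqxx.
      by rewrite eE !inE => /orP[]->; rewrite ?orbT.
    have [z zm] := contract_map_surj m.
    exists z; left; apply/subsetP => v; rewrite inE => vX.
    case: (eqVneq (contract_map e v) (contract_map e x)) => [/contract_mapP[->|[]]|vx].
    + by rewrite !inE eqxx.
    + by rewrite eE !inE => /orP[]->; rewrite ?orbT.
    have /contract_mapP[->|[]] : contract_map e v = contract_map e z.
      rewrite zm; apply/eqP; apply: contraTT Xle => vm; rewrite -ltnNge.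
      by apply/card_gt1P; exists (contract_map e v), m; rewrite mX vm !inE vx vX.
      by rewrite !inE eqxx orbT.
    by rewrite eE !inE => /orP[]->; rewrite ?orbT.
  exists x; right; rewrite -ltnS; apply: leq_ltn_trans X3.
  have inj : {in S &, injective (contract_map e)}.
    move=> u v uS vS /contract_mapP[//|[ue ve]].
    have /contract_mapP E : u = x \/ u \in ends e /\ x \in ends e.
      by right; rewrite ue eE !inE eqxx.
    by move: uS; rewrite inE E (negPf xX).
  rewrite -(card_in_imset inj); apply: subset_leq_card.
  by apply/subsetP => _ /imsetP[v + ->]; rewrite inE.
case: Sz => [Sz|S2]; last by have := G3 S A S2; rewrite sep.
case: (ltnP 2 #|S|) => S2; last by have := G3 S A S2; rewrite sep.
have SE : S = [set x; y; z].
  apply/eqP; rewrite eqEcard Sz (leq_trans _ S2) //.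
  have sz : size [:: x; y; z] = 3 by [].
  rewrite -sz; apply: leq_trans (card_size _); apply: subset_leq_card.
  by apply/subsetP => v; rewrite !inE -!orbA.
by move/forallP/(_ z)/forallP/(_ A): c3; rewrite -SE sep.
Qed.

Lemma minor_map_contract (T : finType) (rT : rel T) (f : vertex G -> T) x y :
  irreflexive rT ->
  ends e = [set x; y] -> f x = f y -> minor_map (@neighbour G) rT f ->
  exists f' : vertex (contract e) -> T,
    minor_map (@neighbour (contract e)) rT f'.
Proof.
move=> rTI eE fxy /minor_mapP[s /fibres_connectedP con real].
have [rep repK] := fin_all_exists contract_map_surj.
have fE v : f (rep (contract_map e v)) = f v.
  have /contract_mapP[->//|[]] := repK (contract_map e v).
  by rewrite eE !inE => /orP[]/eqP-> /orP[]/eqP->.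
exists (f \o rep); apply/minor_mapP; split.
- by move=> a; have [u <-] := s a; exists (contract_map e u); rewrite /= fE.
- apply/fibres_connectedP => U clU p q pU /= fpq.
  have : rep q \in [set v | contract_map e v \in U].
    apply: (con _ _ (rep p)) => //; last by rewrite inE repK.
    move=> u v; rewrite !inE => uU ruv fuv.
    case: (neighbour_contract ruv) => [<-//|cuv].
    by apply: clU uU cuv _; rewrite /= !fE.
  by rewrite inE repK.
- move=> a b rab; have [u [v [fu fv ruv]]] := real a b rab.
  exists (contract_map e u), (contract_map e v); rewrite /= !fE; split=> //.
  case: (neighbour_contract ruv) => // /contract_mapP uv; exfalso.
  have E : f u = f v by rewrite -(fE u) -(fE v); congr (f (rep _)); exact/contract_mapP.
  by move: rab; rewrite -fu -fv E rTI.
Qed.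

Lemma card_contract x y : x != y -> ends e = [set x; y] ->
  #|vertex (contract e)| < #|vertex G|.
Proof.
move=> xy eE; have [rep repK] := fin_all_exists contract_map_surj.
have inj : injective rep by move=> p q E; rewrite -(repK p) E repK.
rewrite -(card_codom inj) -[#|vertex G|]cardsT; apply: proper_card.
apply/properP; split; first by apply/subsetP => v; rewrite inE.
have cxy : contract_map e x = contract_map e y.
  by apply/contract_mapP; right; rewrite eE !inE !eqxx orbT.
have K v : v \in codom rep -> v = rep (contract_map e v).
  by move=> /codomP[p ->]; rewrite repK.
case: (boolP (x \in codom rep)) => [xr|]; last by exists x; rewrite ?inE.
exists y; rewrite ?inE //; apply/negP => /K yr.
by case/eqP: xy; rewrite yr -cxy; exact: K.
Qed.

End ContractMap.

Lemma has_minor_spanning (G H : mgraph) (f : vertex G -> vertex H)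
    (g : edge H -> edge G) :
  bijective f -> injective g -> (forall h, ends h = f @: ends (g h)) -> has_minor G H.
Proof.
have [n] := ubnP #|edge G|; elim: n G f g => // n IH G f g; rewrite ltnS => Gn fB gI gE.
case: (boolP [forall e, e \in codom g]) => [/forallP all|].
  have gB : bijective g.
    apply: inj_card_bij => //; rewrite -(card_codom gI).
    by apply: subset_leq_card; apply/subsetP.
  have [g' gK g'K] := gB; apply: has_minor_iso; exists f, g'; split=> //.
    by exists g.
  by move=> e; rewrite gE g'K.
rewrite negb_forall => /existsP[e eg].
have ne h : g h != e by apply: contraNneq eg => <-; exact: codom_f.
apply: (has_minor_dele (e := e)).
apply: (IH (delete_edge e) f (fun h => Sub (g h) (ne h) : edge (delete_edge e))) => //.
  rewrite card_sub; apply: leq_trans Gn; apply: proper_card.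
  by apply/properP; split; [apply/subsetP|exists e; rewrite ?inE ?eqxx].
by move=> h h' /(congr1 val); rewrite !SubK => /gI.
Qed.

Lemma minor_map_has_minor (G H : mgraph) (f : vertex G -> vertex H) :
  simple H -> minor_map (@neighbour G) (@neighbour H) f -> has_minor G H.
Proof.
move=> [H2 HI]; have [n] := ubnP #|vertex G|; elim: n G f => // n IH G f.
rewrite ltnS => Gn mf; have /minor_mapP[s /fibres_connectedP con real] := mf.
case: (boolP (injectiveb f)) => [/injectiveP fI|/injectivePn[p [q pq fpq]]].
  have fB : bijective f.
    apply: inj_card_bij => //; rewrite -(card_codom fI).
    by apply: subset_leq_card; apply/subsetP => a _; have [u <-] := s a; exact: codom_f.
  have [g gE] : exists g : edge H -> edge G, forall h, ends h = f @: ends (g h).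
    apply: (@fin_all_exists _ (fun=> edge G) (fun h e => ends h = f @: ends e)) => h.
    have /eqP/cards2P[a [b [ab hE]]] := H2 h.
    have [|u [v [fu fv /neighbourP[_ [e eE]]]]] := real a b.
      by apply/neighbourP; split; [exact/eqP|exists h].
    by exists e; rewrite eE imsetU !imset_set1 fu fv.
  apply: (has_minor_spanning fB _ gE) => h h' E; apply: HI.
  by rewrite gE E -gE.
case: (boolP [exists w, neighbour p w && (f p == f w)]) => [/existsP[w /andP[]]|].
  move=> /neighbourP[/eqP pw [e eE]] /eqP fpw.
  have [f' mf'] := minor_map_contract (@neighbourI H) eE fpw mf.
  apply: (has_minor_contract (e := e)); apply: IH mf'.
  exact: leq_trans (card_contract pw eE) Gn.
rewrite negb_exists => /forallP n0; exfalso.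
have : q \in [set p].
  apply: (con _ _ p q); rewrite ?inE // => a b; rewrite inE => /eqP-> rab fab.
  by have := n0 b; rewrite rab fab eqxx.
by rewrite inE eq_sym (negPf pq).
Qed.

Lemma contractible_minor_has_minor (G H : mgraph) (e : edge G) x y :
  simple H -> ends e = [set x; y] ->
  contractible_minor (@neighbour G) (@neighbour H) x y -> has_minor (contract e) H.
Proof.
move=> sH eE /contractible_minorP[_ [f mf fxy]].
have [f' mf'] := minor_map_contract (@neighbourI H) eE fxy mf.
exact: minor_map_has_minor mf'.
Qed.

Section PartialMinorMaps.

Definition partial_minor_map (G H : mgraph) (f : vertex G -> option (vertex H)) :=
  [/\ forall a, exists u, f u = Some a,
      forall U : {set vertex G},
        (forall u v, u \in U -> adjacent u v -> f u = f v -> v \in U) ->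
        forall a u v, f u = Some a -> f v = Some a -> u \in U -> v \in U &
      forall h : edge H, exists e : edge G, f @: ends e = some @: ends h].

Lemma has_minor_partial (G H : mgraph) : has_minor G H ->
  exists f : vertex G -> option (vertex H), partial_minor_map f.
Proof.
elim=> {G H} [G H [f [g [fB [g' gK g'K] gE]]]|G H v _|G H e _|G H e _].
- have [f' fK f'K] := fB; exists (some \o f); split.
  + by move=> a; exists (f' a); rewrite /= f'K.
  + by move=> U _ a u v /= [<-] [/(can_inj fK)->].
  + by move=> h; exists (g' h); rewrite imset_comp -gE g'K.
- move=> [f [s con real]].
  pose f' w := oapp f None (insub w : option (vertex (delete_vertices [set v]))).
  have f'E w : f' (val w) = f w by rewrite /f' valK.
  have f'S w a : f' w = Some a -> exists w' : vertex (delete_vertices [set v]), w = val w'.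
    by rewrite /f'; case: insubP => //= w' _ <- _; exists w'.
  exists f'; split.
  + by move=> a; have [u fu] := s a; exists (val u); rewrite f'E.
  + move=> U clU a u w fu fw uU.
    have [u' uE] := f'S u a fu; have [w' wE] := f'S w a fw; subst u w.
    suff : w' \in [set t : vertex (delete_vertices [set v]) | val t \in U] by rewrite inE.
    apply: (con _ _ a u' w'); rewrite ?inE -?f'E // => p q.
    rewrite !inE -!f'E => pU /adjacentP[e eE] fpq; apply: clU pU _ fpq.
    apply/adjacentP; exists (val e); apply/setP => t.
    have in_e t' : (t' \in ends e) = (val t' \in ends (val e)) by rewrite inE.
    case: (boolP (t \in [set v])) => tv.
      rewrite (disjointFl (valP e) tv); apply/esym/negP; rewrite !inE => /orP[]/eqP E.
        by have := valP p; rewrite -E tv.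
      by have := valP q; rewrite -E tv.
    have -> : t = val (Sub t tv : vertex (delete_vertices [set v])) by rewrite SubK.
    by rewrite -in_e eE !inE !(inj_eq val_inj).
  + move=> h; have [e eE] := real h; exists (val e); rewrite -eE.
    apply/setP => o; apply/imsetP/imsetP => -[t te ->].
      have tv : t \notin [set v] by rewrite (disjointFr (valP e) te).
      exists (Sub t tv : vertex (delete_vertices [set v])); first by rewrite inE SubK.
      by rewrite -f'E SubK.
    by exists (val t); rewrite ?f'E //; rewrite inE in te.
- move=> [f [s con real]]; exists f; split=> //.
  + move=> U clU a p q fp fq; apply: (con _ _ a p q) => // u v uU /adjacentP[d dE].
    apply: clU => //.
    by apply/adjacentP; exists (val d).
  + by move=> h; have [d dE] := real h; exists (val d).
- move=> [f [s con real]]; exists (f \o contract_map e); split.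
  + move=> a; have [p fp] := s a; have [u uE] := contract_map_surj p.
    by exists u; rewrite /= uE.
  + move=> U clU a u v /= fu fv uU.
    have sat p q : contract_map e p = contract_map e q -> p \in U -> q \in U.
      move=> cpq pU; case: (eqVneq p q) => [<-//|/eqP pq].
      apply: (clU p) => //=; last by rewrite cpq.
      have /contract_mapP[//|[pe qe]] := cpq.
      by apply/adjacentP; exists e; exact: neighbour_ends.
    have : contract_map e v \in contract_map e @: U.
      apply: (con _ _ a (contract_map e u)) => //; last exact: imset_f.
      move=> _ q /imsetP[p pU ->] /adjacentP[d dE] fpq.
      have dE' : contract_map e @: ends (val d) = [set contract_map e p; q] by [].
      have [p' p'd p'E] : exists2 p', p' \in ends (val d) & contract_map e p' = contract_map e p.
        have : contract_map e p \in [set contract_map e p; q] by rewrite !inE eqxx.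
        by rewrite -dE' => /imsetP[p' ? ?]; exists p'.
      have [q' q'd q'E] : exists2 q', q' \in ends (val d) & contract_map e q' = q.
        have : q \in [set contract_map e p; q] by rewrite !inE eqxx orbT.
        by rewrite -dE' => /imsetP[q' ? ?]; exists q'.
      apply/imsetP; exists q'; last by [].
      have p'U : p' \in U by exact: sat (esym p'E) pU.
      case: (eqVneq p' q') => [<-//|/eqP pq'].
      apply: (clU p') => //=; last by rewrite p'E q'E.
      by apply/adjacentP; exists (val d); exact: neighbour_ends.
    by move=> /imsetP[w wU /esym wE]; exact: sat wE wU.
  + move=> h; have [d dE] := real h; exists (val d); rewrite -dE.
    by rewrite imset_comp.
Qed.

Lemma partial_minor_map_total (G H : mgraph) (f : vertex G -> option (vertex H)) :
  0 < #|vertex H| -> connected3 (@neighbour G) -> partial_minor_map f ->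
  exists f' : vertex G -> vertex H, minor_map (@neighbour G) (@neighbour H) f'.
Proof.
move=> /card_gt0P[a0 _] G3.
have [n] := ubnP #|[set u | f u == None]|; elim: n f => // n IH f; rewrite ltnS => fn.
move=> pf; have [s con real] := pf.
case: (set_0Vmem [set u | f u == None]) => [all|[u0 u0N]].
  pose f' v := odflt a0 (f v).
  have fE v : f v = Some (f' v).
    rewrite /f'; case fv: (f v) => [//|].
    by have := in_set0 v; rewrite -all inE fv.
  exists f'; apply/minor_mapP; split.
  - by move=> a; have [u fu] := s a; exists u; rewrite /f' fu.
  - apply/fibres_connectedP => U clU u v uU fuv.
    apply: (con U _ (f' u) u v) => //; last by rewrite fuv.
    move=> p q pU pq; rewrite !fE => -[fpq].
    case: (eqVneq p q) => [<-//|npq]; apply: clU pU _ fpq.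
    by rewrite /neighbour npq.
  - move=> a b /neighbourP[ab [h hE]]; have [e eE] := real h.
    have mem c : c \in ends h -> exists2 u, u \in ends e & f' u = c.
      move=> ch; have : Some c \in f @: ends e by rewrite eE imset_f.
      by move=> /imsetP[u ue]; rewrite fE => -[->]; exists u.
    have [|u ue fu] := mem a; first by rewrite hE !inE eqxx.
    have [|v ve fv] := mem b; first by rewrite hE !inE eqxx orbT.
    exists u, v; split=> //; have uv : u <> v by move=> E; apply: ab; rewrite -fu -fv E.
    by apply/neighbourP; split=> //; exists e; exact: neighbour_ends.
have [v [u [vS uN uv]]] : exists v u, [/\ f v != None, f u = None & adjacent v u].
  pose A := [set v | f v != None].
  case: (boolP [exists v in A, exists u, (u \notin A) && neighbour v u]).
    move=> /exists_inP[v]; rewrite inE => vA /existsP[u /andP[]]; rewrite inE negbK.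
    by move=> /eqP fu /andP[_ vu]; exists v, u.
  rewrite negb_exists_in => /forall_inP no; exfalso.
  have := G3 set0 A; rewrite cards0 => /(_ isT)/negP; apply; apply/separatesP; split.
  - by have [w fw] := s a0; exists w; rewrite inE fw.
  - by move=> w _; rewrite inE.
  - by exists u0; rewrite !inE negbK; move: u0N; rewrite inE.
  - move=> p q pA rpq qA; have := no p pA; rewrite negb_exists => /forallP/(_ q).
    by rewrite qA rpq.
pose f' w := if w == u then f v else f w.
have f'u : f' u = f v by rewrite /f' eqxx.
have f'N w : w != u -> f' w = f w by move=> /negPf wu; rewrite /f' wu.
have f'S w a : f w = Some a -> f' w = Some a.
  by move=> fw; rewrite f'N //; apply/eqP => E; rewrite E uN in fw.
apply: (IH f').
  apply: leq_trans fn; apply: proper_card; apply/properP; split.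
    apply/subsetP => w; rewrite !inE /f'; case: (eqVneq w u) => [->|//].
    by rewrite (negPf vS).
  by exists u; rewrite inE ?uN // f'u.
have [c fv] : exists c, f v = Some c by case: (f v) vS => // c _; exists c.
split.
- by move=> a; have [w fw] := s a; exists w; exact: f'S.
- move=> U clU.
  have uvU : (u \in U) = (v \in U).
    have f'v : f' v = f' u by rewrite f'u (f'S v c) ?f'u ?fv.
    by apply/idP/idP => h; apply: (clU _ _ h); rewrite // adjacentC.
  have main a p q : f p = Some a -> f q = Some a -> p \in U -> q \in U.
    move=> fp fq pU; suff : q \in [set w in U | f w != None] by rewrite inE => /andP[].
    apply: (con _ _ a p q) => //; last by rewrite inE pU fp.
    move=> x y; rewrite !inE => /andP[xU fx] xy fxy; rewrite -fxy fx andbT.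
    apply: (clU x) => //; case fxE: (f x) => [b|]; last by rewrite fxE in fx.
    by rewrite (f'S x b) // (f'S y b) // -fxy.
  have red p a : f' p = Some a -> exists p', f p' = Some a /\ (p' \in U) = (p \in U).
    case: (eqVneq p u) => [->|pu]; first by rewrite f'u uvU; exists v.
    by rewrite f'N //; exists p.
  move=> a p q /red[p' [fp <-]] /red[q' [fq <-]]; exact: main fp fq.
- move=> h; have [e eE] := real h; exists e; rewrite -eE.
  apply: eq_in_imset => w we; rewrite f'N //; apply/eqP => wu.
  have : f w \in some @: ends h by rewrite -eE imset_f.
  by rewrite wu uN => /imsetP[].
Qed.

End PartialMinorMaps.

Lemma has_minor_minor_map (G H : mgraph) :
  0 < #|vertex H| -> connected3 (@neighbour G) -> has_minor G H ->
  exists f : vertex G -> vertex H, minor_map (@neighbour G) (@neighbour H) f.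
Proof.
by move=> H0 G3 /has_minor_partial[f pf]; exact: partial_minor_map_total pf.
Qed.

(** * Forests *)

Definition acyclic (G : mgraph) (F : {set edge G}) : Prop :=
  forall n (v : 'I_n.+1 -> vertex G) (c : 'I_n.+1 -> edge G),
    is_cycle v c -> ~ (forall i, c i \in F).

Lemma ordS_closed n (I : {set 'I_n.+1}) j :
  j \in I -> (forall i, i \in I -> ordS i \in I) -> forall i, i \in I.
Proof.
move=> jI cl i.
have itI k : iter k (@ordS _) j \in I by elim: k => //= k; exact: cl.
have itE k : iter k (@ordS _) j = (j + k) %% n.+1 :> nat.
  elim: k => [|k IH] /=; first by rewrite addn0 modn_small.
  by rewrite IH -addn1 modnDml addn1 addnS.
have -> : i = iter (i + (n.+1 - j)) (@ordS _) j; last exact: itI.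
apply: val_inj; rewrite /= itE addnCA subnKC ?modnDr ?modn_small //.
exact: ltnW.
Qed.

Lemma acyclic_extend (G : mgraph) (T : eqType) (l : vertex G -> T)
    (F : {set edge G}) (e : edge G) p q :
  acyclic F -> (forall f, f \in F -> {in ends f &, forall u v, l u = l v}) ->
  p \in ends e -> q \in ends e -> l p <> l q -> acyclic (e |: F).
Proof.
move=> aF lF pe qe lpq n v c cyc all.
have [_ cI cE] := cyc.
have [i0 i0F] : exists i, c i \notin F.
  apply/existsP; apply: contraT; rewrite negb_exists => /forallP h.
  by case: (aF n v c cyc) => i; have := h i; rewrite negbK.
have ci0 : c i0 = e by have := all i0; rewrite !inE (negPf i0F) orbF => /eqP.
have cF i : i != i0 -> c i \in F.
  have := all i; rewrite !inE => /orP[/eqP|//].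
  by rewrite -ci0 => /cI->; rewrite eqxx.
pose I := [set i | l (v i) == l (v (ordS i0))].
have lE : l (v i0) = l (v (ordS i0)).
  case: (eqVneq (l (v i0)) (l (v (ordS i0)))) => // /eqP ne.
  have : i0 \in I; last by rewrite inE => /eqP.
  apply: (@ordS_closed _ I (ordS i0)); first by rewrite inE.
  move=> i; rewrite !inE => /eqP li.
  have ii0 : i != i0 by apply/eqP => E; apply: ne; rewrite -li E.
  by rewrite -li (lF _ (cF i ii0) (v i) (v (ordS i))) // cE !inE eqxx ?orbT.
move: pe qe; rewrite -ci0 cE !inE => /orP[]/eqP pE /orP[]/eqP qE; apply: lpq;
  by rewrite pE qE.
Qed.

(* l labels the components of the graph formed by F with K identified to a
   point, so each edge added to F loses exactly one label. *)
Lemma forest_labelling (G : mgraph) (K : {set vertex G}) (P : {pred edge G}) :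
  0 < #|K| -> exists (l : vertex G -> vertex G) (F : {set edge G}),
  [/\ acyclic F, {subset F <= P}, (forall e, e \in F -> ~~ (ends e \subset K)),
      #|vertex G| < #|l @: setT| + #|F| + #|K| &
      forall e, e \in P -> {in ends e &, forall u v, l u = l v}].
Proof.
move=> /card_gt0P[k0 k0K].
suff H n : forall (l : vertex G -> vertex G) (F : {set edge G}), #|~: F| < n ->
  [/\ acyclic F, {subset F <= P}, (forall e, e \in F -> ~~ (ends e \subset K)),
      {in K &, forall u v, l u = l v} /\ #|vertex G| < #|l @: setT| + #|F| + #|K| &
      forall e, e \in F -> {in ends e &, forall u v, l u = l v}] ->
  exists (l : vertex G -> vertex G) (F : {set edge G}),
  [/\ acyclic F, {subset F <= P}, (forall e, e \in F -> ~~ (ends e \subset K)),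
      #|vertex G| < #|l @: setT| + #|F| + #|K| &
      forall e, e \in P -> {in ends e &, forall u v, l u = l v}].
  apply: (H _ (fun v => if v \in K then k0 else v) set0 (ltnSn _)).
  split=> //; try by move=> e; rewrite inE.
    by move=> m v c _ /(_ ord0); rewrite inE.
  split; first by move=> u v -> ->.
  rewrite cards0 addn0 -(cardsC K) addnC ltn_add2r.
  have -> : #|~: K|.+1 = #|k0 |: ~: K| by rewrite cardsU1 inE k0K.
  apply: subset_leq_card; apply/subsetP => v vK; apply/imsetP; exists v => //.
  by move: vK; rewrite !inE => /orP[/eqP->|/negPf->] //; rewrite k0K.
elim: n => // n IH l F Fn [aF FP FK [lK cnt] lF].
case: (boolP [forall e in P, forall u in ends e, forall v in ends e, l u == l v]).
  move=> /forall_inP h; exists l, F; split=> // e eP u v ue ve.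
  by have /forall_inP/(_ u ue)/forall_inP/(_ v ve)/eqP := h e eP.
rewrite negb_forall_in => /exists_inP[e eP]; rewrite negb_forall_in => /exists_inP[p pe].
rewrite negb_forall_in => /exists_inP[q qe /eqP lpq].
have eF : e \notin F by apply/negP => /lF h; apply: lpq; exact: h.
apply: (IH (fun w => if l w == l p then l q else l w) (e |: F)).
  rewrite -ltnS; apply: leq_trans Fn; rewrite ltnS; apply: proper_card.
  by apply/properP; split; [rewrite setCS subsetUr|exists e; rewrite !inE ?eqxx].
split.
- exact: acyclic_extend aF lF pe qe lpq.
- by move=> f; rewrite !inE => /orP[/eqP->|/FP].
- move=> f; rewrite !inE => /orP[/eqP->|/FK//].
  by apply/negP => /subsetP h; apply: lpq; apply: lK; exact: h.
- split; first by move=> u v uK vK; rewrite (lK u v).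
  rewrite cardsU1 eF; apply: (leq_trans cnt).
  set l' := (fun w => if _ then _ else _); suff : #|l @: setT| <= #|[set l p]| + #|l' @: setT|.
    by rewrite cards1; lia.
  apply: leq_trans (leq_card_setU _ _).1.
  apply: subset_leq_card; apply/subsetP => _ /imsetP[w _ ->]; rewrite !inE.
  case: (eqVneq (l w) (l p)) => //= lw; apply/imsetP; exists w => //.
  by rewrite /l' (negPf lw).
- move=> f; rewrite !inE => /orP[/eqP->|fF] u v; last by move=> ue ve; rewrite (lF f fF u v).
  have pq : p <> q by move=> E; apply: lpq; rewrite E.
  rewrite (neighbour_ends pe qe pq) !inE.
  by move=> /orP[]/eqP-> /orP[]/eqP->; rewrite /= ?eqxx //; case: eqP.
Qed.

Lemma contract_keeps_subgraph (G : mgraph) (K : subgraph G) (e : edge G) :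
  ~~ (ends e \subset svertex K) -> keeps_subgraph e K.
Proof.
move=> eK; have eNK : e \notin sedge K by apply: contra eK; exact: sends.
split.
  move=> u v uK vK /contract_mapP[//|[ue ve]].
  case: (eqVneq u v) => // /eqP uv; case/negP: eK.
  by rewrite (neighbour_ends ue ve uv); apply/subsetP => w; rewrite !inE => /orP[]/eqP->.
pose E : {set edge (contract e)} := [set f | val f \in sedge K].
have ES f : f \in E -> ends f \subset contract_map e @: svertex K.
  by rewrite inE => fK; apply: imsetS; exact: sends.
exists (Subgraph ES); split=> //; apply/setP => f; apply/imsetP/idP => [[f']|fK].
  by rewrite inE => fK ->.
have fe : f != e by apply: contraTneq fK => ->.
by exists (Sub f fe); rewrite ?inE SubK.
Qed.

Lemma exists_subset_card (T : finType) (A : {set T}) m : m <= #|A| ->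
  exists2 B : {set T}, B \subset A & #|B| = m.
Proof.
move=> mA; exists [set x in take m (enum A)].
  by apply/subsetP => x; rewrite inE => /mem_take; rewrite mem_enum.
rewrite cardsE (card_uniqP _) ?take_uniq ?enum_uniq // size_take_min -cardE.
exact/minn_idPl.
Qed.

Lemma labels_le_blocks (V T : finType) (r : rel V) (rT : rel T) (l : V -> V) :
  (forall x y, good r rT x y -> l x = l y) ->
  #|l @: setT| <= #|blocks r rT|.
Proof.
move=> lg; have lc x y : connect (good r rT) x y -> l y = l x.
  move=> xy; apply/eqP.
  have : y \in [set z | l z == l x]; last by rewrite inE.
  apply: connect_stable xy _; last by rewrite inE.
  by move=> u v; rewrite !inE => /eqP <- /lg ->.
apply: leq_trans (leq_imset_card (fun A : {set V} => [set l x | x in A]) _).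
rewrite -(card_imset _ (@set1_inj V)); apply: subset_leq_card.
apply/subsetP => _ /imsetP[_ /imsetP[x _ ->] ->].
apply/imsetP; exists [set y in setT | connect (good r rT) x y]; first exact: imset_f.
apply/setP => t; apply/set1P/imsetP => [->|[y + ->]].
  by exists x; rewrite // !inE connect0.
by rewrite !inE; exact: lc.
Qed.

Theorem corollary3 (G H : mgraph) (K : subgraph G)
    (G3 : kconnected 3 G)
    (H_nonempty : 0 < #|vertex H|) (H_simple : simple H) (H3 : kconnected 3 H)
    (GH : has_minor G H)
    (K_nonempty : 0 < #|svertex K|)
    (nondegenerate : #|svertex K| = 1 -> #|vertex H| < #|vertex G|) :
  exists F : subgraph G,
    [/\ forest F,
        #|sedge F| = uphalf (#|vertex G| - #|vertex H| + 1) + 1 - #|svertex K|,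
        [disjoint sedge F & sedge K] &
        forall e : edge G, e \in sedge F ->
          [/\ kconnected 3 (contract e),
              has_minor (contract e) H &
              keeps_subgraph e K]].
Proof.
have g3 := kconnected3_connected3 G3; have h3 := kconnected3_connected3 H3.
have [f mf] := has_minor_minor_map H_nonempty g3 GH.
pose gd := good (@neighbour G) (@neighbour H).
pose P := [pred e : edge G | [exists x, exists y, (ends e == [set x; y]) && gd x y]].
have [l [F [aF FP FK cnt lP]]] := forest_labelling P K_nonempty.
have lb : #|l @: setT| <= #|blocks (@neighbour G) (@neighbour H)|.
  apply: labels_le_blocks => x y xy.
  have /neighbourP[_ [e eE]] := good_adj xy.
  apply: (lP e); rewrite ?eE ?inE ?eqxx ?orbT //.
  by apply/existsP; exists x; apply/existsP; exists y; rewrite eE eqxx.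
have [F' F'F F'm] : exists2 F' : {set edge G}, F' \subset F &
    #|F'| = uphalf (#|vertex G| - #|vertex H| + 1) + 1 - #|svertex K|.
  apply: exists_subset_card; case: (ltnP #|vertex H| #|vertex G|) => ltHG.
    have := card_blocks (@neighbourC G) (@neighbourI G) g3
      (@neighbourI H) h3 mf ltHG.
    move: lb cnt ltHG; rewrite uphalf_half.
    move: #|_ @: _| #|blocks _ _| #|F| #|vertex G| #|vertex H| #|svertex K|.
    by move=> a b c d i j *; lia.
  have -> : #|vertex G| - #|vertex H| = 0 by apply/eqP.
  have : #|svertex K| != 1 by apply/eqP => /nondegenerate; rewrite ltnNge ltHG.
  by move: K_nonempty; case: #|svertex K| => [|[|k]].
exists (@Subgraph G setT F' (fun _ _ => subsetT _)); split=> //=.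
- by move=> n v c cyc all; apply: (aF n v c cyc) => i; exact: (subsetP F'F).
- rewrite disjoint_subset; apply/subsetP => e /(subsetP F'F)/FK eK.
  by apply: contra eK; exact: sends.
- move=> e /(subsetP F'F) eF.
  have /existsP[x /existsP[y /andP[/eqP eE /andP[xy c3]]]] := FP e eF.
  split.
  + exact: contract_kconnected3 g3 eE c3.
  + exact: contractible_minor_has_minor H_simple eE xy.
  + exact/contract_keeps_subgraph/FK.
Qed.
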